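(* Let $B$ be a densely defined closed symmetric operator with deficiency indices $(1,1)$ on a Hilbert space $\mathcal{H}$, with self-adjoint extensions $T_\theta$, and let $\mathcal{M}$ be the cyclicity space of the deficiency vector $u_+$. Let $\theta_0\in[0,\pi)$ be fixed. Then $$\{\theta\in[0,\pi] : \sigma_p(T_\theta\upharpoonright_{\mathcal{M}})\cap\sigma(T_{\theta_0}\upharpoonright_{\mathcal{M}})=\varnothing\}$$ is a dense $G_\delta$ set in $[0,\pi]$.
   Context: $\mathcal{H}$ is a complex Hilbert space. The deficiency spaces of $B$ are $K_\pm(B)=\mathrm{Ran}(B\pm iI)^\perp=\mathrm{Ker}(B^*\mp iI)$, both one-dimensional; $u_\pm\in K_\pm(B)$ are fixed unit vectors, and $u_+$ is called the deficiency vector. For $\theta\in[0,\pi)$, $T_\theta$ is the self-adjoint extension of $B$ with domain $D(T_\theta)=D(B)\dotplus\mathrm{span}\{u_++e^{-2i\theta}u_-\}$ and $T_\theta(x+au_++ae^{-2i\theta}u_-)=Bx+aiu_+-aie^{-2i\theta}u_-$ for $x\in D(B)$, $a\in\mathbb{C}$. The same formula is used for $\theta=\pi$, so that $T_\pi=T_0$. The cyclicity space of $u_+$ is $\mathcal{M}=\overline{\mathrm{span}\{(T_\theta-zI)^{-1}u_+:z\in\mathbb{C}\setminus\mathbb{R}\}}$; it does not depend on $\theta$ and reduces every $T_\theta$. $T_\theta\upharpoonright_{\mathcal{M}}$ is the self-adjoint operator on $\mathcal{M}$ with domain $D(T_\theta)\cap\mathcal{M}$. $\sigma$ denotes spectrum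 and $\sigma_p$ the set of eigenvalues. *)

(* Defs.v *)
From HB Require Import structures.
From mathcomp Require Import all_boot all_order all_algebra.
From mathcomp Require Import sesquilinear complex.
From mathcomp Require Import all_classical all_reals all_analysis borel_hierarchy.

Set Implicit Arguments.
Unset Strict Implicit.
Unset Printing Implicit Defensive.

Import Order.TTheory GRing.Theory Num.Theory Num.Def.
Import numFieldNormedType.Exports.

Local Open Scope classical_set_scope.
Local Open Scope ring_scope.
Local Open Scope complex_scope.

(** A complex Hilbert space is a [completeNormedModType R[i]] whose norm comes
    from an inner product [ip : {dot H for conjC}] (linear in the first
    argument, conjugate-linear in the second) via [norm_of_ip].

    A partially defined operator of [H] is represented by its graph, a subset
    of [H * H]: [G (x, y)] means that [x] is in the domain and [G x = y]. *)

Section Operators.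
Variables (R : realType) (H : completeNormedModType R[i]).
Variable ip : {dot H for conjC}.
Implicit Types (G : set (H * H)) (M V : set H) (u x : H) (z : R[i]).

Definition norm_of_ip := forall x, `|x| ^+ 2 = ip x x.

Definition linear_operator G :=
  [/\ G (0, 0),
      forall a p q, G p -> G q -> G (a *: p.1 + q.1, a *: p.2 + q.2) &
      forall x y y', G (x, y) -> G (x, y') -> y = y'].

Definition op_dom G : set H := [set p.1 | p in G].

Definition op_ran G : set H := [set p.2 | p in G].

Definition op_inv G : set (H * H) := [set p | G (p.2, p.1)].

(* graph of G - z I *)
Definition op_shift G z : set (H * H) := [set (p.1, p.2 - z *: p.1) | p in G].

Definition op_restrict G M : set (H * H) := [set p | G p /\ M p.1].

Definition densely_defined G := dense (op_dom G).

Definition closed_operator G := closed G.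

Definition symmetric_operator G :=
  forall p q, G p -> G q -> ip p.2 q.1 = ip p.1 q.2.

Definition orthocompl V : set H := [set u | forall v, V v -> ip v u = 0].

(* K_+(B) = Ran(B + iI)^perp and K_-(B) = Ran(B - iI)^perp *)
Definition Kplus G := orthocompl (op_ran (op_shift G (- 'i))).
Definition Kminus G := orthocompl (op_ran (op_shift G 'i)).

Definition lin_span V : set H :=
  [set v | exists n (c : 'I_n -> R[i]) (e : 'I_n -> H),
     (forall i, V (e i)) /\ v = \sum_i c i *: e i].

Definition has_dim V n :=
  exists e : 'I_n -> H,
    (forall c : 'I_n -> R[i], \sum_i c i *: e i = 0 -> forall i, c i = 0) /\
    V = lin_span (range e).

Definition deficiency_indices G m n := has_dim (Kplus G) m /\ has_dim (Kminus G) n.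

(* exp (i t) *)
Definition cis (t : R) : R[i] := cos t +i* sin t.

Definition T_ext G (uplus uminus : H) (theta : R) : set (H * H) :=
  [set p | exists q (a : R[i]), G q /\
     p = (q.1 + a *: uplus + (a * cis (- (2 * theta))) *: uminus,
          q.2 + (a * 'i) *: uplus - (a * 'i * cis (- (2 * theta))) *: uminus)].

Definition cyclicity_space G u : set H :=
  closure (lin_span
    [set x | exists2 z, z \isn't Num.real & op_inv (op_shift G z) (u, x)]).

(** In the next three definitions [G] is an operator in the Hilbert space [M], a
    closed subspace of [H]: its domain and its range are included in [M]. *)

Definition resolvent_set M G : set R[i] :=
  [set z | [/\ forall x, op_shift G z (x, 0) -> x = 0,
               op_ran (op_shift G z) = M &
               exists c : R, forall p,
                 op_inv (op_shift G z) p -> `|p.2| <= c%:C * `|p.1|]].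

Definition spectrum M G : set R[i] := ~` resolvent_set M G.

Definition point_spectrum G : set R[i] :=
  [set z | exists2 x, x != 0 & G (x, z *: x)].

End Operators.

(* Main.v *)
Require Import Defs.
From HB Require Import structures.
From mathcomp Require Import all_boot all_order all_algebra.
From mathcomp Require Import sesquilinear complex.
From mathcomp Require Import all_classical all_reals all_analysis borel_hierarchy.
From mathcomp Require Import ring lra.

Set Implicit Arguments.
Unset Strict Implicit.
Unset Printing Implicit Defensive.

Import Order.TTheory GRing.Theory Num.Theory Num.Def.
Import numFieldNormedType.Exports.

Local Open Scope classical_set_scope.
Local Open Scope ring_scope.
Local Open Scope complex_scope.

(** Every eigenvector of an extension that lies in the cyclicity space [M] can be
    normalized to [x = b + up + w um] with [b] in the domain of [B]
    ([eigenP]); [w = exp (- 2 i theta)] is then the boundary parameter of the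
    extension. Green's formula ([green]) gives, for two such vectors,
    [(l - l') <x, x'> = 2 i (1 - w w'^* )] ([eigenvec_green]), so the eigenvalue
    determines the parameter.

    Let [A] be the part of [T theta0] in [M]. The exceptional parameters are
    those [theta] for which some such [x] has its eigenvalue [l] in the spectrum
    of [A]. They are cut into countably many pieces ([piece]), indexed by a bound
    on [|x|], a small interval containing [l], and a positive lower bound for the
    inner products of [x] with all competing eigenvectors.

    The pieces are closed ([piece_closed]): bounded normalized eigenvectors have
    weak limits of the same kind, and convex combinations turn weak limits into
    strong ones ([eigenvec_closed], from [nested_midconvex]). They cover the
    exceptional set ([piece_cover]), because by the same weak compactness
    eigenvectors of bounded norm with eigenvalue near [l] are weakly close to [x].

    A piece contains no interval ([piece_no_arc]). On a piece Green's formula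
    bounds [|l - l'|] by a multiple of [|w - w'|]; so along an interval of
    parameters [l] moves continuously, and it cannot be constant, hence it sweeps
    an interval of real numbers contained in the spectrum of [A]. But there the
    eigenvectors, corrected by a multiple of [up], give solutions of
    [(A - l) y = up] of bounded norm ([eigenvec_resolvent_up]). In the spectral
    representation of [A] this says that the integrals of [1 / (t - l)^2] against
    the measure of [up] are bounded for [l] in the interval, which forces that
    measure, and by cyclicity the spectrum, to avoid the interval: a
    contradiction. Baire's theorem concludes.

    The last implication ([gap_resolvent_set]) is obtained without the spectral
    theorem. If [psi] is in the domain of [A] and its resolvents are bounded by
    [C] on [[l - r, l + r]], then [psi / U_(N-1) ((A - l) / r)] can be formed from
    the resolvents at the zeros of the Chebyshev polynomial [U_(N-1)]; the Pell
    identity together with Parseval's identity for the discrete sine transform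
    shows that [|psi|^2 - |(A - l) psi / r|^2] is at most [2 (r C)^2 / (N - 2)].
    Letting [N] grow gives [r |psi| <= |(A - l) psi|], which by density holds on
    the whole domain. *)

(** * Real-valued norm and inner product *)

Section Hilbert.
Variables (R : realType) (H : completeNormedModType R[i]).
Variables (ip : {dot H for conjC}) (ip_norm : norm_of_ip ip).
Implicit Types (x y z u v : H) (a b c : R[i]).

Definition re_ip x y : R := complex.Re (ip x y).

Definition rnorm x : R := complex.Re `|x|.

Lemma ipDl x y z : ip (x + y) z = ip x z + ip y z.
Proof. exact: linearDl. Qed.

Lemma ipDr x y z : ip x (y + z) = ip x y + ip x z.
Proof. exact: linearDr. Qed.

Lemma ipNl x z : ip (- x) z = - ip x z.
Proof. exact: linearNl. Qed.

Lemma ipNr x z : ip x (- z) = - ip x z.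
Proof. exact: linearNr. Qed.

Lemma ipZl a x y : ip (a *: x) y = a * ip x y.
Proof. exact: linearZl_LR. Qed.

Lemma ipZr a x y : ip x (a *: y) = conjc a * ip x y.
Proof. exact: linearZr_LR. Qed.

Lemma ip0l y : ip 0 y = 0. Proof. exact: linear0l. Qed.
Lemma ip0r y : ip y 0 = 0. Proof. exact: linear0r. Qed.

Lemma conjC_real (r : R) : conjc r%:C = r%:C.
Proof. exact: conjc_real. Qed.

Definition ipE := (ipDl, ipDr, ipNl, ipNr, ipZl, ipZr).

Lemma ipC x y : ip x y = conjc (ip y x).
Proof. by rewrite (hermC ip) expr0 mul1r. Qed.

Lemma ip_self x : ip x x = ((rnorm x) ^+ 2)%:C.
Proof.
by rewrite -ip_norm /rnorm rmorphXn /= RRe_real // ger0_real.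
Qed.

Lemma rnormE x : `|x| = (rnorm x)%:C.
Proof. by rewrite /rnorm RRe_real // ger0_real. Qed.

Lemma rnorm_ge0 x : 0 <= rnorm x.
Proof. by rewrite -ler0c -rnormE. Qed.

Lemma rnorm_eq0 x : rnorm x = 0 -> x = 0.
Proof. by move=> h; apply/eqP; rewrite -normr_eq0 rnormE h. Qed.

Lemma rnorm0 : rnorm 0 = 0.
Proof. by rewrite /rnorm normr0. Qed.

Lemma rnormN x : rnorm (- x) = rnorm x.
Proof. by rewrite /rnorm normrN. Qed.

Lemma rnormB x y : rnorm (x - y) = rnorm (y - x).
Proof. by rewrite /rnorm distrC. Qed.

Lemma rnormD x y : rnorm (x + y) <= rnorm x + rnorm y.
Proof. by rewrite -lecR rmorphD /= -!rnormE ler_normD. Qed.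

Lemma rnorm_triangle z x y : rnorm (x - y) <= rnorm (x - z) + rnorm (z - y).
Proof. by have := rnormD (x - z) (z - y); rewrite addrA subrK. Qed.

Lemma rnormZ a x : rnorm (a *: x) = Normc.normc a * rnorm x.
Proof.
apply: complexI; rewrite rmorphM /= -!rnormE normrZ; congr (_ * _).
Qed.

Lemma rnormZr (t : R) x : rnorm (t%:C *: x) = `|t| * rnorm x.
Proof. by rewrite rnormZ /= expr0n /= addr0 sqrtr_sqr. Qed.

Lemma rip_self x : re_ip x x = rnorm x ^+ 2.
Proof. by rewrite /re_ip ip_self. Qed.

Lemma ripC x y : re_ip x y = re_ip y x.
Proof. by rewrite /re_ip ipC; case: (ip y x). Qed.

Lemma ripDl x y z : re_ip (x + y) z = re_ip x z + re_ip y z.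
Proof. by rewrite /re_ip ipDl; case: (ip x z) (ip y z) => ? ? []. Qed.

Lemma ripNl x z : re_ip (- x) z = - re_ip x z.
Proof. by rewrite /re_ip ipNl; case: (ip x z). Qed.

Lemma ripDr x y z : re_ip z (x + y) = re_ip z x + re_ip z y.
Proof. by rewrite ripC ripDl !(ripC z). Qed.

Lemma ripNr x z : re_ip z (- x) = - re_ip z x.
Proof. by rewrite ripC ripNl ripC. Qed.

Lemma ripZl (t : R) x y : re_ip (t%:C *: x) y = t * re_ip x y.
Proof. by rewrite /re_ip ipZl; case: (ip x y) => p q /=; rewrite mul0r subr0. Qed.

Lemma ripZr (t : R) x y : re_ip x (t%:C *: y) = t * re_ip x y.
Proof. by rewrite ripC ripZl ripC. Qed.

Lemma rip0l y : re_ip 0 y = 0. Proof. by rewrite /re_ip ip0l. Qed.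
Lemma rip0r y : re_ip y 0 = 0. Proof. by rewrite /re_ip ip0r. Qed.

Definition ripE := (ripDl, ripDr, ripNl, ripNr, ripZl, ripZr).

Lemma rip_le x y : re_ip x y <= rnorm x * rnorm y.
Proof.
case: (eqVneq (rnorm y) 0) => [/rnorm_eq0 ->|y0].
  by rewrite rip0r rnorm0 mulr0.
have y1 : 0 < rnorm y by rewrite lt_def y0 rnorm_ge0.
case: (eqVneq (rnorm x) 0) => [/rnorm_eq0 ->|x0].
  by rewrite rip0l rnorm0 mul0r.
have x1 : 0 < rnorm x by rewrite lt_def x0 rnorm_ge0.
have := sqr_ge0 (rnorm ((rnorm y)%:C *: x - (rnorm x)%:C *: y)).
rewrite -rip_self !ripE !rip_self (ripC y x).
move: (rnorm x) (rnorm y) (re_ip x y) x1 y1 => p q r p0 q0 h.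
have : 0 <= (p * q) * (p * q - r) by nra.
by rewrite pmulr_rge0 ?mulr_gt0// subr_ge0.
Qed.

(** Rotating [x] by the phase of [ip x y] reduces to the real part. *)
Lemma ip_le x y : Normc.normc (ip x y) <= rnorm x * rnorm y.
Proof.
have [->|n0] := eqVneq (ip x y) 0.
  by rewrite Normc.normc0 mulr_ge0 ?rnorm_ge0.
have n1 : Normc.normc (ip x y) != 0.
  by apply: contra_neq n0; exact: Normc.eq0_normc.
have n2 : 0 < Normc.normc (ip x y) by rewrite lt_def n1; case: (ip x y) => ? ? /=; rewrite sqrtr_ge0.
have := rip_le (conjc (ip x y) *: x) y.
rewrite rnormZ /re_ip ipZl.
have -> : conjc (ip x y) * ip x y = (Normc.normc (ip x y) ^+ 2)%:C.
  by rewrite mulrC -sqr_normc rmorphXn.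
have -> : Normc.normc (conjc (ip x y)) = Normc.normc (ip x y) :> R.
  by case: (ip x y) => p q /=; rewrite sqrrN.
by rewrite /= expr2 -mulrA ler_pM2l.
Qed.

Lemma parallelogram x y :
  rnorm (x - y) ^+ 2 = 2 * rnorm x ^+ 2 + 2 * rnorm y ^+ 2
     - 4 * rnorm ((2^-1)%:C *: (x + y)) ^+ 2.
Proof.
rewrite rnormZr exprMn -!rip_self !ripE !rip_self (ripC y x) -normrX ger0_norm ?exprn_ge0//; lra.
Qed.

(** Closure ([closure_adherent]), phrased with the real-valued norm so that
    estimates stay in [R]. *)
Definition adherent (V : set H) x :=
  forall e : R, 0 < e -> exists2 v, V v & rnorm (x - v) < e.

Lemma ball_rnorm x (e : R) : ball x e%:C = [set y | rnorm (x - y) < e].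
Proof.
by rewrite -ball_normE; apply/seteqP; split => y /=; rewrite rnormE ltcR.
Qed.

Lemma nbhs_rnorm x (A : set H) :
  nbhs x A -> exists2 e : R, 0 < e & forall y, rnorm (x - y) < e -> A y.
Proof.
move/nbhs_ballP => [e /= e0 eA].
have er : e = (complex.Re e)%:C by rewrite RRe_real ?gtr0_real.
exists (complex.Re e); first by rewrite -ltcR -er.
by move=> y yx; apply: eA; rewrite er ball_rnorm.
Qed.

Lemma closure_adherent (V : set H) x : closure V x <-> adherent V x.
Proof.
split=> [cV e e0|aV A /nbhs_rnorm[e e0 eA]].
  have := cV (ball x e%:C) _; case=> [|v [Vv]].
    by apply: nbhsx_ballx; rewrite ltcR.
  by rewrite ball_rnorm; exists v.
by have [v Vv xv] := aV e e0; exists v; split => //; exact: eA.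
Qed.

Lemma closed_pairP (G : set (H * H)) (p : H * H) : closed G ->
  (forall e : R, 0 < e ->
    exists2 q, G q & rnorm (p.1 - q.1) < e /\ rnorm (p.2 - q.2) < e) -> G p.
Proof.
move=> cG aG; apply: cG => A [[A1 A2] /= [/nbhs_rnorm[e1 e10 A1e]]].
move=> /nbhs_rnorm[e2 e20 A2e] sA.
have e0 : 0 < Num.min e1 e2 by rewrite lt_min e10.
have [q Gq [q1 q2]] := aG _ e0.
exists q; split => //; apply: sA; split => /=.
  by apply: A1e; rewrite (lt_le_trans q1)// ge_min lexx.
by apply: A2e; rewrite (lt_le_trans q2)// ge_min lexx orbT.
Qed.

Lemma complete_rnorm (f : nat -> H) :
  (forall e : R, 0 < e -> exists N, forall k l, (N <= k)%N -> (N <= l)%N ->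
     rnorm (f k - f l) < e) ->
  exists x, forall e : R, 0 < e -> exists N, forall k, (N <= k)%N -> rnorm (x - f k) < e.
Proof.
move=> cf.
have : cvg (f @ \oo).
  apply: cauchy_cvg; apply: cauchy_exP => e e0.
  have er : e = (complex.Re e)%:C by rewrite RRe_real ?gtr0_real.
  have [|N fN] := cf (complex.Re e); first by rewrite -ltcR -er.
  exists (f N); exists N => // k /= Nk.
  by rewrite er ball_rnorm /=; exact: fN.
move=> /cvg_ex[x fx]; exists x => e e0.
have /cvgrPdist_lt/(_ e%:C) := fx.
rewrite ltcR => /(_ e0)[N _ fN]; exists N => k Nk.
by rewrite -ltcR -rnormE; exact: fN.
Qed.

End Hilbert.

(** * Orthogonal projection *)

Lemma invS_lt (R : realType) (e : R) : 0 < e ->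
  exists N, forall k, (N <= k)%N -> k.+1%:R^-1 < e.
Proof.
move=> e0; exists (Num.truncn e^-1) => k Nk.
by rewrite invf_plt ?posrE// -truncn_le_nat.
Qed.

Lemma complete_real (R : realType) (f : nat -> R) :
  (forall e : R, 0 < e -> exists N, forall k l, (N <= k)%N -> (N <= l)%N ->
     `|f k - f l| < e) ->
  exists x, forall e : R, 0 < e -> exists N, forall k, (N <= k)%N -> `|x - f k| < e.
Proof.
move=> cf.
have : cvg (f @ \oo).
  apply: cauchy_cvg; apply: cauchy_exP => e e0; have [N fN] := cf e e0.
  by exists (f N); exists N => // k /= Nk; rewrite -ball_normE /=; exact: fN.
move=> /cvg_ex[x fx]; exists x => e e0.
have /cvgrPdist_lt/(_ e e0)[N _ fN] := fx.
by exists N => k Nk; exact: fN.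
Qed.

Section Projection.
Variables (R : realType) (H : completeNormedModType R[i]).
Variables (ip : {dot H for conjC}) (ip_norm : norm_of_ip ip).
Implicit Types (x y z u v : H) (a b c : R[i]).

Local Notation rip := (re_ip ip).

(** Convexity restricted to midpoints, which is all that the parallelogram law
    uses. *)
Definition midconvex (D : set H) :=
  forall x y, D x -> D y -> D ((2^-1)%:C *: (x + y)).

(** Near-minimizers of the norm on [D k] form a Cauchy sequence: the minima
    increase and are bounded, and the midpoint of two near-minimizers cannot be
    much shorter than either. This replaces weak sequential compactness. *)
Lemma nested_midconvex (D : nat -> set H) (n : R) :
  (forall k, D k !=set0) -> (forall k, D k.+1 `<=` D k) ->
  (forall k, midconvex (D k)) -> (forall x, D 0%N x -> rnorm x <= n) ->
  exists z (f : nat -> H), (forall k, D k (f k)) /\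
    forall e : R, 0 < e -> exists N, forall k, (N <= k)%N -> rnorm (z - f k) < e.
Proof.
move=> D0 Ddec Dmid Dn.
have Dle k l : (k <= l)%N -> D l `<=` D k.
  move=> /subnK <-; elim: (l - k)%N => // m IH; rewrite addSn.
  exact: subset_trans (@Ddec _) IH.
pose A k : set R := [set rnorm x ^+ 2 | x in D k].
pose d k := inf (A k).
have A0 k : A k !=set0 by have [x Dx] := D0 k; exists (rnorm x ^+ 2), x.
have Alb k : has_lbound (A k).
  by exists 0 => _ [x _ <-]; rewrite sqr_ge0.
have dle k x : D k x -> d k <= rnorm x ^+ 2.
  by move=> Dx; apply: ge_inf => //; exists x.
have dinc k l : (k <= l)%N -> d k <= d l.
  move=> kl; apply: lb_le_inf => // _ [x Dx <-].
  by apply: dle; exact: Dle Dx.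
have dn k : d k <= n ^+ 2.
  have [x Dx] := D0 k; apply: (le_trans (dle _ _ Dx)).
  have xn : rnorm x <= n by apply: Dn; exact: Dle Dx.
  by rewrite ler_sqr ?nnegrE ?rnorm_ge0// (le_trans (rnorm_ge0 x)).
have hs : has_sup (range d).
  by split; [exists (d 0%N), 0%N | exists (n ^+ 2) => _ [k _ <-]].
pose L := sup (range d).
have dL k : d k <= L by apply: ub_le_sup; [exact: hs.2|exists k].
have Ld (e : R) : 0 < e -> exists N, forall k, (N <= k)%N -> L - e < d k.
  move=> e0; have [_ [N _ <-] LN] := sup_adherent e0 hs.
  by exists N => k Nk; rewrite (lt_le_trans LN)// dinc.
have /choice[f fP] : forall k, exists x, D k x /\ rnorm x ^+ 2 < d k + k.+1%:R^-1.
  move=> k; have k0 : 0 < (k.+1%:R^-1 : R) by rewrite invr_gt0.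
  have [_ [x Dx <-] xd] := inf_adherent k0 (conj (A0 k) (Alb k)).
  by exists x.
have [|z zP] := @complete_rnorm _ H f.
  move=> e e0; have e1 : 0 < e ^+ 2 / 16 by rewrite divr_gt0 ?exprn_gt0.
  have [N1 N1P] := Ld _ e1.
  have [N2 N2P] := invS_lt e1.
  have cauchy k l : (maxn N1 N2 <= k)%N -> (k <= l)%N -> rnorm (f k - f l) < e.
    rewrite geq_max => /andP[N1k N2k] kl.
    rewrite -(@ltr_pXn2r _ 2) ?nnegrE ?rnorm_ge0 ?(ltW e0)//.
    have [Dk fk] := fP k; have [Dl fl] := fP l.
    have := N1P _ N1k; have := N2P _ N2k; have := N2P _ (leq_trans N2k kl).
    have := dL l; have := dinc _ _ kl.
    have := dle k _ (Dmid k _ _ Dk (Dle _ _ kl _ Dl)).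
    have := parallelogram ip_norm (f k) (f l).
    move: fk fl; move: (k.+1%:R^-1) (l.+1%:R^-1) => ek el.
    move: (rnorm (f k)) (rnorm (f l)) (rnorm _) (rnorm _) => p q r s.
    move: (d k) (d l) => dk dl; lra.
  exists (maxn N1 N2) => k l Nk Nl.
  by case: (leqP k l) => [|/ltnW] kl; [|rewrite rnormB]; exact: cauchy.
by exists z, f; split => // k; have [] := fP k.
Qed.

Lemma half_addxx v : (2^-1)%:C *: (v + v) = v.
Proof.
have -> : v + v = (2 : R)%:C *: v.
  by rewrite (_ : (2 : R)%:C = 1 + 1) ?scalerDl ?scale1r// rmorphD rmorph1.
by rewrite scalerA -rmorphM mulVf ?scale1r// pnatr_eq0.
Qed.

(** The vectors [v - m] of almost minimal length form nested convex sets; their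
    limit is the perpendicular, since moving it along [u] cannot shorten it. *)
Lemma projection (V : set H) : V 0 ->
  (forall a x y, V x -> V y -> V (a *: x + y)) ->
  forall v, exists2 p, adherent V p & forall u, V u -> ip u (v - p) = 0.
Proof.
move=> V0 Vlin v.
pose A : set R := [set rnorm (v - m) | m in V].
pose d := inf A.
have hA : has_inf A.
  split; first by exists (rnorm (v - 0)), 0.
  by exists 0 => _ [m _ <-]; exact: rnorm_ge0.
have dle m : V m -> d <= rnorm (v - m).
  by move=> Vm; apply: ge_inf; [exact: hA.2|exists m].
have VB x y : V x -> V y -> V (x - y).
  by move=> Vx Vy; rewrite addrC -scaleN1r; exact: Vlin.
pose D k : set H := [set x | V (v - x) /\ rnorm x < d + k.+1%:R^-1].
have [k|k x [Vx xd]|k x y [Vx xd] [Vy yd]|x [Vx xd]|z [f [Df zf]]] :=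
    @nested_midconvex D (d + 1).
- have k0 : 0 < (k.+1%:R^-1 : R) by rewrite invr_gt0.
  have [_ [m Vm <-] md] := inf_adherent k0 hA.
  by exists (v - m); split => //; rewrite opprB addrCA subrr addr0.
- split => //; apply: (lt_le_trans xd); rewrite lerD2l lef_pV2 ?posrE//.
  by rewrite ler_nat.
- split.
    have -> : v - (2^-1)%:C *: (x + y) = (2^-1)%:C *: ((v - x) + (v - y)).
      by rewrite -[in LHS](half_addxx v) -scalerBr opprD addrACA.
    rewrite -[_ *: _]addr0; apply: (Vlin) => //.
    by rewrite -[v - x]scale1r; exact: Vlin.
  rewrite rnormZr ger0_norm ?invr_ge0//; have := rnormD x y.
  move: xd yd; move: (k.+1%:R^-1) (rnorm _) (rnorm _) (rnorm _) => e p q r; lra.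
- by rewrite -[1]invr1 ltW.
have zd : rnorm z <= d.
  apply/ler_addgt0Pr => e e0.
  have e2 : 0 < e / 2 by rewrite divr_gt0.
  have [N1 N1P] := zf _ e2; have [N2 N2P] := invS_lt e2.
  have := N1P _ (leq_maxl N1 N2); have := N2P _ (leq_maxr N1 N2).
  have [_] := Df (maxn N1 N2); move: (f _) (_^-1) => y t.
  by have := rnormD (z - y) y; rewrite subrK; lra.
have dz u : V u -> d <= rnorm (z - u).
  move=> Vu; apply/ler_addgt0Pr => e e0; have [N NP] := zf _ e0.
  have := NP _ (leqnn N); have [Vy _] := Df N; move: (f N) Vy => y Vy.
  have Vs : V (u + (v - y)) by rewrite -[u]scale1r; exact: Vlin.
  have := dle _ Vs; rewrite opprD addrCA opprB (addrC v) subrK addrC.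
  by have := rnorm_triangle z y u; rewrite (rnormB y z); lra.
exists (v - z).
  move=> e e0; have [N NP] := zf _ e0; exists (v - f N).
    by have [] := Df N.
  by rewrite opprB addrC addrA subrK rnormB; exact: NP.
move=> u Vu; rewrite opprB addrC subrK.
(* a step along [u] short enough for the first-order term to dominate *)
pose w := ip z u; pose t : R := (rnorm u ^+ 2 + 1)^-1.
have := dz ((t%:C * w) *: u); rewrite -[(_ * _) *: u]addr0 => /(_ (Vlin _ _ _ Vu V0)).
rewrite addr0 => /(le_trans zd).
rewrite -(@ler_pXn2r _ 2) ?nnegrE ?rnorm_ge0//.
have -> : rnorm (z - (t%:C * w) *: u) ^+ 2 =
    rnorm z ^+ 2 - 2 * t * Normc.normc w ^+ 2
    + t ^+ 2 * Normc.normc w ^+ 2 * rnorm u ^+ 2.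
  have -> : t ^+ 2 * Normc.normc w ^+ 2 * rnorm u ^+ 2 =
      rip ((t%:C * w) *: u) ((t%:C * w) *: u).
    rewrite (rip_self ip_norm) rnormZ Normc.normcM !exprMn /= expr0n addr0.
    by rewrite sqrtr_sqr real_normK ?num_real.
  rewrite -!(rip_self ip_norm) !ripE (ripC _ _ z).
  have -> : rip z ((t%:C * w) *: u) = t * Normc.normc w ^+ 2.
    rewrite -scalerA ripZr /re_ip ipZr -/w; congr (_ * _).
    rewrite mulrC -sqr_normc; case: (w) => p q.
    by rewrite normc_def -rmorphXn.
  ring.
have t0 : 0 < t by rewrite invr_gt0 ltr_wpDl ?sqr_ge0.
have tQ : t * rnorm u ^+ 2 = 1 - t.
  have : t * (rnorm u ^+ 2 + 1) = 1 by rewrite mulVf// gt_eqF// ltr_wpDl ?sqr_ge0.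
  by move: (rnorm u ^+ 2) => Q; lra.
rewrite [t ^+ 2 * _ * _](_ : _ = t * Normc.normc w ^+ 2 * (1 - t)); last first.
  by rewrite -tQ; ring.
move=> h; have : Normc.normc w ^+ 2 <= 0.
  rewrite -(pmulr_rle0 _ t0).
  have := sqr_ge0 (Normc.normc w); move: h.
  move: (rnorm z ^+ 2) (Normc.normc w ^+ 2) => p c2; nra.
rewrite le_eqVlt ltNge sqr_ge0 orbF expf_eq0 /= => /eqP/Normc.eq0_normc w0.
by rewrite ipC -/w w0 conjc0.
Qed.

End Projection.

(** * Discrete sine transform *)

Section SineTransform.
Variable R : realType.
Implicit Types (x y : R) (n j k l : nat).

Lemma sin_natpi n : sin (n%:R * pi) = 0 :> R.
Proof.
elim: n => [|n IH]; first by rewrite mul0r sin0.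
by rewrite -natr1 mulrDl mul1r sinDpi IH oppr0.
Qed.

Lemma sin_succ n x :
  sin (n.+2%:R * x) + sin (n%:R * x) = 2 * cos x * sin (n.+1%:R * x).
Proof.
have -> : n.+2%:R * x = n.+1%:R * x + x by rewrite -natr1; ring.
have -> : n%:R * x = n.+1%:R * x - x by rewrite -[n.+1%:R]natr1; ring.
by rewrite !sinD sinN cosN; ring.
Qed.

(** The right-hand side is a discrete Wronskian of two solutions of
    [sin_succ], with different values of [2 cos]. *)
Lemma sum_sin_sin n x y :
  2 * (cos x - cos y) * (\sum_(k < n.+1) sin (k%:R * x) * sin (k%:R * y)) =
  sin (n.+1%:R * x) * sin (n%:R * y) - sin (n%:R * x) * sin (n.+1%:R * y).
Proof.
elim: n => [|n IH]; first by rewrite big_ord1 !mul0r sin0 !mul0r !mulr0 subr0.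
rewrite big_ord_recr /= mulrDr IH.
have -> : sin (n.+2%:R * x) = 2 * cos x * sin (n.+1%:R * x) - sin (n%:R * x).
  by rewrite -sin_succ addrK.
have -> : sin (n.+2%:R * y) = 2 * cos y * sin (n.+1%:R * y) - sin (n%:R * y).
  by rewrite -sin_succ addrK.
ring.
Qed.

Lemma sum_cos n x : 2 * sin x * (\sum_(k < n) cos (2 * k%:R * x)) =
  sin ((2 * n%:R - 1) * x) + sin x.
Proof.
elim: n => [|n IH]; first by rewrite big_ord0 mulr0 mulr0 sub0r mulN1r sinN addNr.
rewrite big_ord_recr /= mulrDr IH.
have -> : (2 * n.+1%:R - 1) * x = 2 * n%:R * x + x by rewrite -natr1; ring.
have -> : (2 * n%:R - 1) * x = 2 * n%:R * x - x by ring.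
by rewrite !sinD sinN cosN; ring.
Qed.

Variable N : nat.
Hypothesis N0 : (0 < N)%N.

(** [cos (node k)], for [0 < k < N], are the zeros of the Chebyshev polynomial
    [U_(N-1)], and [sine j k] is [sin (node k)] times the value of [U_(j-1)] there. *)
Definition node k : R := k%:R * pi / N%:R.

Definition sine j k : R := sin (j%:R * node k).

Lemma sineC j k : sine j k = sine k j.
Proof. by rewrite /sine /node; congr sin; ring. Qed.

Lemma sineN k : sine N k = 0.
Proof.
rewrite /sine /node mulrC mulfVK ?sin_natpi//.
by rewrite pnatr_eq0 -lt0n.
Qed.

Lemma sine_succ j k :
  sine j.+2 k + sine j k = 2 * cos (node k) * sine j.+1 k.
Proof. exact: sin_succ. Qed.

Lemma node_itv k : (k < N)%N -> 0 <= node k < pi.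
Proof.
move=> kN; have NR : 0 < N%:R :> R by rewrite ltr0n.
rewrite /node mulr_ge0 ?mulr_ge0 ?pi_ge0 ?invr_ge0 ?ler0n//=.
by rewrite ltr_pdivrMr// mulrC ltr_pM2l ?pi_gt0// ltr_nat.
Qed.

Lemma sine_orthogonal k l : (k < N)%N -> (l < N)%N -> k != l ->
  \sum_(j < N) sine j k * sine j l = 0.
Proof.
move=> kN lN kl.
have [/andP[k0 kpi] /andP[l0 lpi]] := (node_itv kN, node_itv lN).
have := sum_sin_sin N.-1 (node k) (node l); rewrite prednK//.
rewrite -/(sine N k) -/(sine N l) !sineN mulr0 mul0r subr0 => /eqP.
rewrite mulf_eq0 => /orP[|/eqP//].
rewrite mulf_eq0 pnatr_eq0 /= subr_eq0 => /eqP/cos_inj.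
rewrite !in_itv /= k0 l0 !ltW// => /(_ isT isT) /eqP.
have h0 : pi / N%:R != 0 :> R.
  by rewrite mulf_neq0 ?invr_eq0 ?(gt_eqF (pi_gt0 R))// pnatr_eq0 -lt0n.
by move=> h; move/negP: kl; case; rewrite -(eqr_nat R) -(inj_eq (mulIf h0)) !mulrA; exact: h.
Qed.

Lemma sine_square k : (0 < k < N)%N -> \sum_(j < N) sine j k ^+ 2 = N%:R / 2.
Proof.
move=> /andP[k0 kN].
have s0 : sin (node k) != 0.
  have /andP[_ kpi] := node_itv kN; rewrite gt_eqF// sin_gt0_pi//.
  by rewrite kpi /node divr_gt0 ?mulr_gt0 ?pi_gt0 ?ltr0n.
have c0 : \sum_(j < N) cos (2 * j%:R * node k) = 0.
  have := sum_cos N (node k).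
  have -> : (2 * N%:R - 1) * node k = (2 * k)%:R * pi - node k.
    rewrite natrM /node; field.
    by rewrite pnatr_eq0 -lt0n.
  rewrite sinD sin_natpi mul0r add0r sinN mulrN.
  have -> : cos ((2 * k)%:R * pi) = 1 :> R.
    have -> : (2 * k)%:R * pi = k%:R * pi + k%:R * pi :> R by rewrite natrM; ring.
    rewrite cosD sin_natpi mul0r subr0 -expr2.
    have := cos2Dsin2 (k%:R * pi : R).
    by rewrite sin_natpi expr0n /= addr0.
  by rewrite mul1r addNr => /eqP; rewrite !mulf_eq0 pnatr_eq0 (negPf s0) => /eqP.
transitivity (\sum_(j < N) (2^-1 - 2^-1 * cos (2 * j%:R * node k))).
  apply: eq_bigr => j _; rewrite /sine.
  have -> : 2 * j%:R * node k = j%:R * node k + j%:R * node k by ring.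
  rewrite cosD; have := cos2Dsin2 (j%:R * node k).
  by move: (cos _) (sin _) => c s; nra.
by rewrite sumrB -mulr_sumr c0 mulr0 subr0 sumr_const card_ord -[LHS]mulr_natl.
Qed.

Lemma sine_le1 j k : sine j k ^+ 2 <= 1.
Proof.
have := cos2Dsin2 (j%:R * node k); rewrite /sine.
by have := sqr_ge0 (cos (j%:R * node k)); lra.
Qed.

End SineTransform.

(** * Localization by Chebyshev polynomials *)

Section LinearRelations.
Variables (R : realType) (H : completeNormedModType R[i]).
Variables (ip : {dot H for conjC}) (ip_norm : norm_of_ip ip).
Implicit Types (x y z u v : H) (a b c : R[i]) (G : set (H * H)).

Local Notation rip := (re_ip ip).

Lemma opD G x y x' y' : linear_operator G ->
  G (x, y) -> G (x', y') -> G (x + x', y + y').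
Proof. by case=> _ GD _ h h'; have := GD 1 _ _ h h'; rewrite /= !scale1r. Qed.

Lemma opZ G a x y : linear_operator G -> G (x, y) -> G (a *: x, a *: y).
Proof. by case=> G0 GD _ h; have := GD a _ _ h G0; rewrite /= !addr0. Qed.

Lemma opB G x y x' y' : linear_operator G ->
  G (x, y) -> G (x', y') -> G (x - x', y - y').
Proof.
move=> Gl h h'; rewrite -[- x']scaleN1r -[- y']scaleN1r.
by apply: opD => //; exact: opZ.
Qed.

Lemma op_sum G (I : finType) (c : I -> R[i]) (x y : I -> H) :
  linear_operator G -> (forall i, G (x i, y i)) ->
  G (\sum_i c i *: x i, \sum_i c i *: y i).
Proof.
move=> Gl h; elim/big_ind2: _ => [|x1 x2 y1 y2 ? ?|i _].
- by case: Gl.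
- exact: opD.
- exact: opZ.
Qed.

Lemma symmetric_rip G p q : symmetric_operator ip G -> G p -> G q ->
  rip p.2 q.1 = rip p.1 q.2.
Proof. by move=> Gs Gp Gq; rewrite /re_ip Gs. Qed.

Lemma rip_suml (I : finType) (f : I -> R) (Y : I -> H) z :
  rip (\sum_k (f k)%:C *: Y k) z = \sum_k f k * rip (Y k) z.
Proof.
elim/big_ind2: _ => [|u s v t <- <-|k _]; first by rewrite rip0l.
- by rewrite ripDl.
- by rewrite ripZl.
Qed.

(** [|h j|^2 + |h j.+1|^2 - 2 <G (h j), h j.+1>] does not depend on [j], by
    symmetry of [G]. For [h j = U_(j-1) (G) g] this is the operator form of the
    Pell identity. *)
Lemma recurrence_energy G (h w : nat -> H) (N : nat) :
  symmetric_operator ip G -> (forall j, (j <= N)%N -> G (h j, w j)) ->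
  (forall j, (j.+1 < N)%N -> w j.+1 + w j.+1 = h j.+2 + h j) ->
  forall j, (j.+1 < N)%N ->
    rip (h j.+1) (h j.+1) - rip (h j) (h j.+2) =
    rip (h N.-1) (h N.-1) + rip (h N) (h N) - 2 * rip (h N.-1) (w N).
Proof.
move=> Gs Gh rec.
have e1 j : (j.+1 < N)%N -> rip (h j.+1) (h j.+1) - rip (h j) (h j.+2) =
    rip (h j.+1) (h j.+1) + rip (h j.+2) (h j.+2) - 2 * rip (h j.+1) (w j.+2).
  move=> jN; have := congr1 (rip^~ (h j.+2)) (rec _ jN).
  rewrite !ripE -(symmetric_rip Gs (Gh _ (ltnW jN)) (Gh _ jN)) /=; lra.
have e2 j : (j.+2 < N)%N -> rip (h j.+2) (h j.+2) - rip (h j.+1) (h j.+3) =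
    rip (h j.+1) (h j.+1) + rip (h j.+2) (h j.+2) - 2 * rip (h j.+1) (w j.+2).
  move=> jN; have := congr1 (rip (h j.+1)) (rec _ jN).
  by rewrite !ripE; lra.
move=> j jN.
have e3 m : (m + j.+1 < N)%N ->
    rip (h j.+1) (h j.+1) - rip (h j) (h j.+2) =
    rip (h (m + j).+1) (h (m + j).+1) - rip (h (m + j)%N) (h (m + j).+2).
  elim: m => // m IH; rewrite addSn => mN; rewrite IH ?(ltnW mN)//.
  by rewrite addnS in mN; rewrite e1 ?(ltnW mN)// addSn e2.
rewrite (e3 (N - j.+2)%N); last by rewrite -addnS subnK.
have eN : ((N - j.+2) + j).+2 = N by rewrite -addnS -addnS subnK.
by move: (_ + j)%N eN => a eN; rewrite e1 -eN.
Qed.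

(** With [s_k = cos (node k)] and [y s] the solution of [(G - s) y = psi], the
    vector [h j] is, up to the factor [N], the partial fraction decomposition of
    [U_(j-1) (G) / U_(N-1) (G)] applied to [psi]; the value [h N], where the
    quotient is no longer a proper fraction, is set apart. *)
Section Normalized.
Variables (G : set (H * H)) (G_lin : linear_operator G).
Hypothesis G_sym : symmetric_operator ip G.
Variables (psi psi' : H) (C : R) (y : R -> H).
Hypothesis Gpsi : G (psi, psi').
Hypothesis Gy : forall s, -1 <= s <= 1 -> G (y s, psi + s%:C *: y s).
Hypothesis yC : forall s, -1 <= s <= 1 -> rnorm (y s) <= C.
Variable m : nat.

Let N := m.+3.
Let cosn (k : 'I_N) : R := cos (node R N k).
Let sn j k : R := sine R N j k.
Let h0 j : H := \sum_(k < N) (sn N.-1 k * sn j k)%:C *: y (cosn k).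
Let h j := if j == N then N%:R%:C *: psi else h0 j.
Let w j := if j == N then N%:R%:C *: psi' else
  \sum_(k < N) (sn N.-1 k * sn j k)%:C *: (psi + (cosn k)%:C *: y (cosn k)).

Let cosn_itv k : -1 <= cosn k <= 1.
Proof. by rewrite /cosn cos_geN1 cos_le1. Qed.

Lemma cheb_graph j : G (h j, w j).
Proof.
rewrite /h /w; case: ifP => _; first exact: opZ.
by apply: op_sum => // k; exact: Gy.
Qed.

(** Since [(G - s_k) y = psi], the recurrence for the sines leaves a multiple of
    [psi], which orthogonality kills except for [j = N.-2], where it provides
    [h N]. *)
Lemma cheb_rec j : (j.+1 < N)%N -> w j.+1 + w j.+1 = h j.+2 + h j.
Proof.
move=> jN; rewrite /w /h (ltn_eqF jN) (ltn_eqF (ltnW jN)).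
under eq_bigr do rewrite scalerDr scalerA -rmorphM.
rewrite big_split /= addrACA -!scaler_suml -scalerDl -!rmorph_sum -rmorphD /=.
have -> : \sum_(k < N) (sn N.-1 k * sn j.+1 k * cosn k)%:C *: y (cosn k) +
   \sum_(k < N) (sn N.-1 k * sn j.+1 k * cosn k)%:C *: y (cosn k) = h0 j.+2 + h0 j.
  rewrite /h0 -!big_split /=; apply: eq_bigr => k _.
  rewrite -!scalerDl -!rmorphD /=; congr (_%:C *: _).
  by rewrite -[RHS]mulrDr /sn sine_succ -/(cosn k); ring.
have sum_ortho i : (0 < i < N)%N -> (i == N.-1) = false ->
    \sum_(k < N) sn N.-1 k * sn i k = 0.
  move=> /andP[i0 iN] iN1; under eq_bigr do rewrite /sn sineC (sineC _ _ i).
  by rewrite sine_orthogonal// eq_sym iN1.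
case: (j.+2 =P N) => [jNN|/eqP jNN].
  have -> : h0 j.+2 = 0.
    rewrite jNN; apply: big1 => k _.
    by rewrite /sn sineN ?mulr0 ?scale0r.
  have -> : \sum_(k < N) sn N.-1 k * sn j.+1 k = N%:R / 2.
    have <- : \sum_(k < N) sine R N k N.-1 ^+ 2 = N%:R / 2.
      by apply: sine_square; rewrite //= ltnSn.
    apply: eq_bigr => k _.
    by rewrite /sn sineC (sineC _ _ j.+1) (_ : j.+1 = N.-1) // -jNN.
  by rewrite add0r -splitr.
rewrite sum_ortho//; first by rewrite addr0 scale0r add0r.
by apply/negP => /eqP jN1; move/negP: jNN; case; rewrite jN1.
Qed.

Lemma cheb_parseval : \sum_(j < N) rip (h0 j) (h0 j) <= N%:R * (N%:R * C ^+ 2).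
Proof.
have rip_sum (I : finType) (f g : I -> R) (Y : I -> H) :
    rip (\sum_k (f k)%:C *: Y k) (\sum_k (g k)%:C *: Y k) =
    \sum_k \sum_l f k * g l * rip (Y k) (Y l).
  rewrite rip_suml; apply: eq_bigr => k _; rewrite ripC rip_suml mulr_sumr.
  by apply: eq_bigr => l _; rewrite mulrA (ripC _ (Y l)).
under eq_bigr do rewrite rip_sum.
rewrite exchange_big /=.
have -> : N%:R * (N%:R * C ^+ 2) = \sum_(k < N) N%:R * C ^+ 2.
  by rewrite sumr_const card_ord -[RHS]mulr_natl.
apply: ler_sum => k _; rewrite exchange_big /= (bigD1 k)//= [X in _ + X]big1 ?addr0.
  have c1 : sn N.-1 k ^+ 2 * rip (y (cosn k)) (y (cosn k)) <= C ^+ 2.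
    have yk := yC (cosn_itv k).
    have : rip (y (cosn k)) (y (cosn k)) <= C ^+ 2.
      by rewrite rip_self// ler_sqr ?nnegrE ?rnorm_ge0 ?(le_trans (rnorm_ge0 _) yk).
    by apply: le_trans; rewrite ler_piMl ?sine_le1// rip_self// sqr_ge0.
  have -> : N%:R * C ^+ 2 = \sum_(j < N) C ^+ 2.
    by rewrite sumr_const card_ord -[RHS]mulr_natl.
  apply: ler_sum => j _.
  apply: le_trans c1; rewrite ler_wpM2r ?rip_self ?sqr_ge0//.
  by rewrite -expr2 exprMn ler_piMr ?sqr_ge0 ?sine_le1.
move=> l lk.
rewrite (eq_bigr (fun j : 'I_N => sn N.-1 k * sn N.-1 l * rip (y (cosn k)) (y (cosn l)) *
   (sine R N j k * sine R N j l))) => [|j _]; last by rewrite /sn; ring.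
by rewrite -mulr_sumr sine_orthogonal ?mulr0// eq_sym.
Qed.

(** The energy is constant: averaging it over [j] bounds it by Parseval, and its
    last value dominates [N^2 (|psi|^2 - |psi'|^2)]. *)
Lemma cheb_bound : m.+1%:R * (rnorm psi ^+ 2 - rnorm psi' ^+ 2) <= 2 * C ^+ 2.
Proof.
pose E := rip (h N.-1) (h N.-1) + rip (h N) (h N) - 2 * rip (h N.-1) (w N).
have Ej := recurrence_energy G_sym (fun j _ => cheb_graph j) cheb_rec.
have NR : 0 < N%:R :> R by rewrite ltr0n.
have E1 : N%:R ^+ 2 * (rnorm psi ^+ 2 - rnorm psi' ^+ 2) <= E.
  (* the energy at [N.-1] is [|h N|^2 - |w N|^2 + |h N.-1 - w N|^2] *)
  have : 0 <= rip (h N.-1 - w N) (h N.-1 - w N) by rewrite rip_self// sqr_ge0.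
  rewrite /E !ripE (ripC _ (w N)).
  have -> : rip (h N) (h N) = N%:R ^+ 2 * rnorm psi ^+ 2.
    by rewrite /h eqxx !ripE rip_self// mulrA.
  have -> : rip (w N) (w N) = N%:R ^+ 2 * rnorm psi' ^+ 2.
    by rewrite /w eqxx !ripE rip_self// mulrA.
  lra.
have hh0 j : (j < N)%N -> h j = h0 j by move=> jN; rewrite /h ltn_eqF.
have E2 : m.+1%:R * E <= 2 * (N%:R * (N%:R * C ^+ 2)).
  apply: le_trans (ler_wpM2l (ler0n _ _) cheb_parseval).
  pose f j := rip (h0 j) (h0 j).
  have f0 j : 0 <= f j by rewrite /f rip_self// sqr_ge0.
  have -> : m.+1%:R * E = \sum_(j < m.+1) E by rewrite sumr_const card_ord mulr_natl.
  apply: (@le_trans _ _ (\sum_(j < m.+1) (f j.+1 + (f j + f j.+2) / 2))).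
    apply: ler_sum => j _; have jN : (j.+2 < N)%N by rewrite 2!ltnS ltn_ord.
    rewrite /E -(Ej j (ltnW jN)) !hh0 ?(ltnW jN) ?(ltnW (ltnW jN))//.
    have : 0 <= rip (h0 j + h0 j.+2) (h0 j + h0 j.+2) by rewrite rip_self// sqr_ge0.
    by rewrite !ripE (ripC _ (h0 j.+2)) /f; lra.
  rewrite big_split /= -mulr_suml big_split /= .
  have s1 : \sum_(j < m.+1) f j <= \sum_(j < N) f j.
    by rewrite [leRHS]big_ord_recr [X in _ <= X + _]big_ord_recr /= -addrA lerDl addr_ge0.
  have s2 : \sum_(j < m.+1) f j.+1 <= \sum_(j < N) f j.
    rewrite [leRHS]big_ord_recr [X in _ <= X + _]big_ord_recl /= -addrA addrCA.
    by rewrite lerDl addr_ge0.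
  have s3 : \sum_(j < m.+1) f j.+2 <= \sum_(j < N) f j.
    rewrite [leRHS]big_ord_recl [X in _ <= _ + X]big_ord_recl /= addrA.
    by rewrite lerDr addr_ge0.
  rewrite -/(f _); move: s1 s2 s3; rewrite -/f.
  by move: (\sum_(j < m.+1) f j) (\sum_(j < m.+1) f j.+1) (\sum_(j < m.+1) f j.+2) (\sum_(j < N) _) => *; lra.
rewrite -(ler_pM2l (exprn_gt0 2 NR)).
rewrite mulrCA; have := ler_wpM2l (ler0n R m.+1) E1; move: E2.
move: (m.+1%:R * E) => *; lra.
Qed.

End Normalized.

Lemma cheb_contraction G psi psi' (C : R) :
  linear_operator G -> symmetric_operator ip G -> G (psi, psi') ->
  (forall s : R, -1 <= s <= 1 ->
     exists2 y, G (y, psi + s%:C *: y) & rnorm y <= C) ->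
  rnorm psi <= rnorm psi'.
Proof.
move=> Gl Gs Gpsi Gy.
have /choice[y yP] : forall s : R, exists y, -1 <= s <= 1 ->
    G (y, psi + s%:C *: y) /\ rnorm y <= C.
  move=> s; case: (boolP (-1 <= s <= 1)) => [/Gy[y y1 y2]|_]; last by exists 0.
  by exists y.
have bound m := cheb_bound Gl Gs Gpsi (fun s hs => (yP s hs).1)
  (fun s hs => (yP s hs).2) m.
rewrite -(@ler_pXn2r _ 2) ?nnegrE ?rnorm_ge0// -subr_le0 leNgt; apply/negP => d0.
have := bound (Num.truncn (2 * C ^+ 2 / (rnorm psi ^+ 2 - rnorm psi' ^+ 2))).
by rewrite leNgt -ltr_pdivrMr// truncnS_gt.
Qed.

(** [cheb_contraction] for [(G - l) / r]. When [G] is self-adjoint, the conclusion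
    reflects that the spectral measure of [psi] does not charge the interior of
    the interval. *)
Lemma bounded_below_of_bounded_resolvent G psi psi' (l r C : R) :
  0 < r -> linear_operator G -> symmetric_operator ip G -> G (psi, psi') ->
  (forall s : R, l - r <= s <= l + r ->
     exists2 y, G (y, psi + s%:C *: y) & rnorm y <= C) ->
  r * rnorm psi <= rnorm (psi' - l%:C *: psi).
Proof.
move=> r0 Gl Gs Gpsi Gy.
have rC : r%:C != 0 :> R[i] by apply/eqP => /complexI r00; rewrite r00 ltxx in r0.
pose G' := [set p : H * H | G (p.1, r%:C *: p.2 + l%:C *: p.1)].
have G'l : linear_operator G'.
  split.
  - by rewrite /G' /= !scaler0 addr0; case: Gl.
  - move=> a [x1 y1] [x2 y2]; rewrite /G' /= => h1 h2.
    have := opD Gl (opZ a Gl h1) h2; congr (G (_, _)).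
    by rewrite !scalerDr addrACA !scalerA !(mulrC a) -!scalerA.
  - move=> x y y'; rewrite /G' /= => h h'; have [_ _ Gf] := Gl.
    have := Gf _ _ _ h h' => /addIr/(congr1 (fun t => r%:C^-1 *: t)).
    by rewrite !scalerA mulVf// !scale1r.
have G's : symmetric_operator ip G'.
  move=> [x1 y1] [x2 y2]; rewrite /G' /= => h1 h2; have := Gs _ _ h1 h2 => /=.
  rewrite !ipE. rewrite !conjC_real => /addIr; exact: mulfI.
have := @cheb_contraction G' psi (r%:C^-1 *: (psi' - l%:C *: psi)) (r * C) G'l G's.
rewrite -rmorphV ?unitfE ?gt_eqF// rnormZr gtr0_norm ?invr_gt0// ler_pdivlMl//.
apply; first by rewrite /G' /= fmorphV scalerA mulfV// scale1r subrK.
move=> s /andP[s1 s2]; have [|y y1 y2] := Gy (l + r * s).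
  by apply/andP; split; nra.
exists (r%:C *: y); last by rewrite rnormZr gtr0_norm// ler_pM2l.
rewrite /G' /=; have := opZ r%:C Gl y1; congr (G (_, _)).
rewrite !scalerDr -addrA; congr (_ + _).
rewrite !scalerA -scalerDl -!rmorphM -rmorphD /=; congr (_%:C *: _); ring.
Qed.

End LinearRelations.

(** * Self-adjoint operators in a closed subspace *)

Section SelfAdjoint.
Variables (R : realType) (H : completeNormedModType R[i]).
Variables (ip : {dot H for conjC}) (ip_norm : norm_of_ip ip).
Implicit Types (x y u v w : H) (a b z : R[i]) (G : set (H * H)) (N : set H).

Definition closed_subspace N :=
  [/\ N 0, forall a x y, N x -> N y -> N (a *: x + y) & adherent N `<=` N].

(** [G] is an operator in the Hilbert space [N]; both ranges of [G +- i] being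
    all of [N] is the usual criterion for a symmetric operator to be self-adjoint. *)
Definition selfadjoint_on N G :=
  [/\ linear_operator G /\ symmetric_operator ip G,
      forall x y, G (x, y) -> N x /\ N y,
      forall v, N v -> exists x, G (x, v + 'i *: x) &
      forall v, N v -> exists x, G (x, v - 'i *: x)].

Lemma subspaceD N x y : closed_subspace N -> N x -> N y -> N (x + y).
Proof. by case=> _ Nl _ Nx Ny; have := Nl 1 _ _ Nx Ny; rewrite scale1r. Qed.

Lemma subspaceZ N a x : closed_subspace N -> N x -> N (a *: x).
Proof. by case=> N0 Nl _ Nx; have := Nl a _ _ Nx N0; rewrite addr0. Qed.

Lemma subspaceB N x y : closed_subspace N -> N x -> N y -> N (x - y).
Proof.
move=> Nc Nx Ny; apply: subspaceD => //; rewrite -scaleN1r; exact: subspaceZ.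
Qed.

Lemma conjc_i : conjc 'i%R = - 'i%R :> R[i].
Proof. by rewrite -complexiE; apply/eqP; rewrite eq_complex /= oppr0 !eqxx. Qed.

Lemma conjcM a b : conjc (a * b) = conjc a * conjc b.
Proof. exact: rmorphM. Qed.

Lemma conjcN a : conjc (- a) = - conjc a.
Proof. exact: rmorphN. Qed.

Lemma Im_i : complex.Im ('i%R : R[i]) = 1.
Proof. by rewrite -complexiE. Qed.

Lemma ip_Im_self G x y : symmetric_operator ip G -> G (x, y) ->
  complex.Im (ip y x) = 0.
Proof.
move=> Gs Gxy; have := Gs _ _ Gxy Gxy; rewrite /= (ipC ip x y).
by case: (ip y x) => p q [] /=; lra.
Qed.

(** The imaginary part of [<v, x>] is [- Im z |x|^2]. *)
Lemma symmetric_lower G z x v : symmetric_operator ip G ->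
  G (x, v + z *: x) -> `|complex.Im z| * rnorm x <= rnorm v.
Proof.
move=> Gs Gx; have := ip_Im_self Gs Gx; rewrite ipDl ipZl (ip_self ip_norm).
have [->|x0] := eqVneq x 0; first by rewrite rnorm0 mulr0 rnorm_ge0.
have x1 : 0 < rnorm x.
  by rewrite lt_def rnorm_ge0 andbT; apply: contra_neq x0; exact: rnorm_eq0.
rewrite -(ler_pM2r x1) -mulrA -expr2; have := ip_le ip_norm v x.
case: (ip v x) z {Gx} => p q [s t] /=; rewrite mulr0 add0r => h e.
apply: le_trans h; have -> : `|t| * rnorm x ^+ 2 = `|q|.
  have -> : q = - (t * rnorm x ^+ 2) by lra.
  by rewrite normrN normrM [`|_ ^+ 2|]ger0_norm// sqr_ge0.
by rewrite -sqrtr_sqr ler_sqrt ?lerDr ?sqr_ge0// addr_ge0 ?sqr_ge0.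
Qed.

Lemma symmetric_inj G z x x' v : linear_operator G -> symmetric_operator ip G ->
  complex.Im z != 0 -> G (x, v + z *: x) -> G (x', v + z *: x') -> x = x'.
Proof.
move=> Gl Gs z0 h h'; apply/eqP; rewrite -subr_eq0; apply/eqP/rnorm_eq0/eqP.
rewrite eq_le rnorm_ge0 andbT.
have := opB Gl h h'; rewrite opprD addrACA subrr -scalerBr => /(symmetric_lower Gs).
by rewrite rnorm0 pmulr_rle0// normr_gt0.
Qed.

(** Maximality: a pair [(x, y)] of the graph of the adjoint belongs to [G]. *)
Lemma selfadjoint_adjoint N G x y : closed_subspace N -> selfadjoint_on N G ->
  N x -> N y -> (forall p q, G (p, q) -> ip q x = ip p y) -> G (x, y).
Proof.
move=> Nc [[Gl Gs] GN Gi GNi] Nx Ny adj.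
(* [x0] solves [(G - i) x0 = y - i x]; then [x - x0] is orthogonal to the range of [G + i] *)
have Nw : N (y - 'i *: x) by apply: subspaceB => //; exact: subspaceZ.
have [x0 Gx0] := Gi _ Nw.
have [e Ge] := GNi _ (subspaceB Nc Nx (GN _ _ Gx0).1).
suff : ip (x - x0) (x - x0) = 0.
  rewrite (ip_self ip_norm) => /complexI/eqP; rewrite expf_eq0 /= => /eqP/rnorm_eq0/eqP.
  by rewrite subr_eq0 => /eqP xx0; move: Gx0; rewrite -xx0 subrK.
have : ip (x - x0 - 'i *: e) x = ip e y by exact: adj.
have := Gs _ _ Ge Gx0 => /=; rewrite !ipE conjc_i.
move: (ip x x) (ip x0 x) (ip e x) (ip e y) (ip x x0) (ip x0 x0) (ip e x0) ('i%R : R[i]).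
move=> a1 a2 a3 a4 a5 a6 a7 j h1 h2.
transitivity ((a1 - a2 - j * a3) - (a5 - a6 - j * a7) + j * a3 - j * a7); first by ring.
by rewrite h1 h2; ring.
Qed.

Lemma small_eq0 (c : R[i]) (K : R) :
  (forall e : R, 0 < e -> Normc.normc c <= K * e) -> c = 0.
Proof.
move=> h; apply: Normc.eq0_normc; apply/eqP; rewrite eq_le.
have -> : 0 <= Normc.normc c by case: (c) => ? ?; exact: sqrtr_ge0.
rewrite andbT; apply/ler_addgt0Pr => e e0; rewrite add0r.
have K0 : 0 < `|K| + 1 by rewrite ltr_wpDl.
apply: le_trans (h (e / (`|K| + 1)) _) _; first by rewrite divr_gt0.
rewrite mulrCA ler_piMr// ?(ltW e0)// ler_pdivrMr// mul1r.
by rewrite (le_trans (ler_norm _))// lerDl.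
Qed.

Lemma normc_ge0 z : 0 <= Normc.normc z.
Proof. by case: z => ? ?; exact: sqrtr_ge0. Qed.

Lemma selfadjoint_closed N G x y : closed_subspace N -> selfadjoint_on N G ->
  (forall e : R, 0 < e -> exists2 q, G q & rnorm (x - q.1) < e /\ rnorm (y - q.2) < e) ->
  G (x, y).
Proof.
move=> Nc Gsa lim; have [[Gl Gs] GN _ _] := Gsa; have [_ _ Na] := Nc.
apply: (selfadjoint_adjoint Nc Gsa).
- by apply: Na => e e0; have [[q1 q2] Gq [h _]] := lim _ e0; exists q1 => //; case: (GN _ _ Gq).
- by apply: Na => e e0; have [[q1 q2] Gq [_ h]] := lim _ e0; exists q2 => //; case: (GN _ _ Gq).
move=> p q Gpq; apply/eqP; rewrite -subr_eq0; apply/eqP.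
apply: (@small_eq0 _ (rnorm q + rnorm p)) => e e0.
have [[q1 q2] Gq /= [h1 h2]] := lim _ e0.
have -> : ip q x - ip p y = ip q (x - q1) + ip p (q2 - y).
  by have /= h := Gs _ _ Gpq Gq; rewrite !ipE h; ring.
apply: le_trans (le_normcD _ _) _; rewrite mulrDl lerD//.
  by apply: le_trans (ip_le ip_norm _ _) _; rewrite ler_wpM2l ?rnorm_ge0// ltW.
apply: le_trans (ip_le ip_norm _ _) _.
by rewrite rnormB ler_wpM2l ?rnorm_ge0// ltW.
Qed.

(** The lower bound makes the preimages of a convergent sequence Cauchy. *)
Lemma closed_range G z (c : R) v : linear_operator G ->
  (forall x y, (forall e : R, 0 < e ->
     exists2 q, G q & rnorm (x - q.1) < e /\ rnorm (y - q.2) < e) -> G (x, y)) ->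
  0 < c -> (forall x w, G (x, w + z *: x) -> c * rnorm x <= rnorm w) ->
  adherent [set w | exists x, G (x, w + z *: x)] v ->
  exists x, G (x, v + z *: x).
Proof.
move=> Gl Gcl c0 lower aVv.
have /choice[f fP] : forall k : nat, exists q, G q /\ rnorm (v - (q.2 - z *: q.1)) < k.+1%:R^-1.
  move=> k; have [|w [x Gx] vw] := aVv k.+1%:R^-1; first by rewrite invr_gt0.
  by exists (x, w + z *: x); rewrite /= addrK.
have fdist k l : c * rnorm ((f k).1 - (f l).1) <= k.+1%:R^-1 + l.+1%:R^-1.
  have [Gk vk] := fP k; have [Gl' vl] := fP l.
  move: (f k) (f l) Gk Gl' vk vl => [x y] [x' y'] /= Gk Gl' vk vl.
  have Gd : G (x - x', (y - z *: x) - (y' - z *: x') + z *: (x - x')).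
    by rewrite scalerBr addrACA subrK -opprD subrK; exact: opB.
  apply: le_trans (lower _ _ Gd) _.
  apply: le_trans (rnorm_triangle v _ _) _.
  by rewrite rnormB lerD// ltW.
have [e e1|x xP] := complete_rnorm (f := fun k => (f k).1) _.
  have e2 : 0 < c * e / 2 by rewrite divr_gt0// mulr_gt0.
  have [n nP] := invS_lt e2; exists n => k l nk nl.
  rewrite -(ltr_pM2l c0); apply: le_lt_trans (fdist k l) _.
  by rewrite [ltRHS]splitr ltrD// nP.
exists x; apply: Gcl => e e1.
have K0 : 0 < 1 + Normc.normc z by rewrite ltr_pwDl// normc_ge0.
have d0 : 0 < e / (1 + Normc.normc z) by rewrite divr_gt0.
have [n1 n1P] := invS_lt d0; have [n2 n2P] := xP _ d0.
have := n1P _ (leq_maxl n1 n2); have := n2P _ (leq_maxr n1 n2).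
have [Gf vf] := fP (maxn n1 n2); move: (f _) Gf vf => [q1 q2] /= Gq vq xq kd.
exists (q1, q2) => //=; split.
  apply: lt_le_trans xq _; rewrite ler_pdivrMr// ler_peMr ?(ltW e1)//.
  by rewrite lerDl normc_ge0.
have -> : v + z *: x - q2 = (v - (q2 - z *: q1)) + z *: (x - q1).
  by rewrite scalerBr opprB addrA addrA addrAC -!addrA; congr (_ + _);
    rewrite addrCA addrC !addrA addrK addrC.
apply: le_lt_trans (rnormD _ _) _; rewrite rnormZ.
have -> : e = e / (1 + Normc.normc z) + Normc.normc z * (e / (1 + Normc.normc z)).
  by field; rewrite gt_eqF.
rewrite ltr_leD ?(lt_trans vq)// ler_wpM2l ?normc_ge0// ltW//.
Qed.

(** The range is closed by the lower bound, and its orthogonal complement is the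
    kernel of [G - z^*]. *)
Lemma selfadjoint_range N G z (c : R) : closed_subspace N -> selfadjoint_on N G ->
  0 < c -> (forall x v, G (x, v + z *: x) -> c * rnorm x <= rnorm v) ->
  (forall x, G (x, conjc z *: x) -> x = 0) ->
  forall v, N v -> exists x, G (x, v + z *: x).
Proof.
move=> Nc Gsa c0 lower inj v Nv.
have [[Gl Gs] GN _ _] := Gsa; have [N0 Nl Na] := Nc.
pose V := [set w | exists x, G (x, w + z *: x)].
have VN : V `<=` N.
  move=> w [x /GN[Nx Nw]]; rewrite -(addrK (z *: x) w).
  by apply: subspaceB => //; exact: subspaceZ.
have [||p aVp perp] := projection ip_norm (V := V) _ _ v.
- by exists 0; rewrite scaler0 addr0; case: Gl.
- move=> a w w' [x Gx] [x' Gx']; exists (a *: x + x').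
  have := opD Gl (opZ a Gl Gx) Gx'; congr (G (_, _)).
  by rewrite !scalerDr addrACA; congr (_ + _ + (_ + _)); rewrite !scalerA mulrC.
have Np : N p.
  apply: Na => e e0; have [w Vw pw] := aVp _ e0; exists w => //; exact: VN.
have e0 : v - p = 0.
  apply: inj; apply: (selfadjoint_adjoint Nc Gsa).
  - exact: subspaceB.
  - by apply: subspaceZ => //; exact: subspaceB.
  move=> x q Gxq; have := perp (q - z *: x) _.
  rewrite [ip x (_ *: _)]ipZr conjcK ipDl ipNl ipZl => h; apply/eqP.
  by rewrite -subr_eq0 h//; exists x; rewrite subrK.
have {aVp} aVv : adherent V v by move/eqP: e0; rewrite subr_eq0 => /eqP ->.
apply: (closed_range Gl _ c0 lower aVv).
by move=> x y; exact: (selfadjoint_closed Nc Gsa).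
Qed.

Lemma selfadjoint_resolvent N G z : closed_subspace N -> selfadjoint_on N G ->
  complex.Im z != 0 -> forall v, N v -> exists x, G (x, v + z *: x).
Proof.
move=> Nc Gsa z0; have [[Gl Gs] _ _ _] := Gsa.
apply: (selfadjoint_range Nc Gsa (c := `|complex.Im z|)); first by rewrite normr_gt0.
  by move=> x v; exact: symmetric_lower.
move=> x Gx; apply: (symmetric_inj Gl Gs (z := conjc z) (v := 0)).
- by case: z z0 {Gx} => p q /=; rewrite oppr_eq0.
- by rewrite add0r.
- by rewrite scaler0 addr0; case: Gl.
Qed.

(** By [selfadjoint_range]: at a real point the lower bound also excludes a kernel
    of the adjoint, so the range is everything. *)
Lemma bounded_below_resolvent_set N G (l c : R) :
  closed_subspace N -> selfadjoint_on N G -> 0 < c ->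
  (forall x y, G (x, y) -> c * rnorm x <= rnorm (y - l%:C *: x)) ->
  resolvent_set N G l%:C.
Proof.
move=> Nc Gsa c0 lower; have [[Gl Gs] GN _ _] := Gsa.
have inj x : G (x, l%:C *: x) -> x = 0.
  move=> /lower; rewrite subrr rnorm0 pmulr_rle0// => x0; apply: rnorm_eq0.
  by apply/eqP; rewrite eq_le x0 rnorm_ge0.
split.
- move=> x [[p q] /= Gpq [<- /eqP]]; rewrite subr_eq0 => /eqP qp.
  by apply: inj; rewrite -qp.
- apply/seteqP; split=> [v [[p q]] [[x y] /= Gxy [_ <-]] <-|v Nv] /=.
    have [Nx Ny] := GN _ _ Gxy.
    by apply: subspaceB => //; exact: subspaceZ.
  have [|x|x Gx] := selfadjoint_range Nc Gsa c0 _ _ Nv (z := l%:C).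
  - by move=> x w /lower; rewrite addrK.
  - by rewrite conjc_real => /inj.
  exists (x, v) => //=; exists (x, v + l%:C *: x) => //=.
  by rewrite addrK.
exists c^-1 => -[v x] [[p q] /= Gpq [<- <-]].
rewrite !rnormE -rmorphM lecR ler_pdivlMl//; exact: lower.
Qed.

Lemma resolvent_set_bounded_below N G (l : R) : resolvent_set N G l%:C ->
  exists2 c : R, 0 < c &
    forall x y, G (x, y) -> c * rnorm x <= rnorm (y - l%:C *: x).
Proof.
move=> [_ _ [c cP]]; exists (`|c| + 1)^-1; first by rewrite invr_gt0 ltr_wpDl.
move=> x y Gxy; rewrite ler_pdivrMl ?ltr_wpDl//.
have := cP (y - l%:C *: x, x) _; rewrite !rnormE -rmorphM lecR.
have h : op_shift G l%:C (x, y - l%:C *: x) by exists (x, y).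
move=> /(_ h) /le_trans; apply; rewrite ler_wpM2r ?rnorm_ge0//.
by rewrite (le_trans (ler_norm c))// lerDl.
Qed.

(** Real resolvent points are characterized by a lower bound, and a lower bound
    survives a small shift of the point. *)
Lemma spectrum_real_closed N G (l : R) : closed_subspace N -> selfadjoint_on N G ->
  (forall e : R, 0 < e -> exists2 l', spectrum N G l'%:C & `|l - l'| < e) ->
  spectrum N G l%:C.
Proof.
move=> Nc Gsa lim /resolvent_set_bounded_below[c c0 lower].
have c2 : 0 < c / 2 by rewrite divr_gt0.
have [l' sl' ll'] := lim _ c2; apply: sl'.
apply: (bounded_below_resolvent_set Nc Gsa c2) => x y Gxy.
have := lower _ _ Gxy; have := rnorm_triangle (l'%:C *: x) y (l%:C *: x).
rewrite -scalerBl -rmorphB rnormZr distrC.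
have := ler_wpM2r (rnorm_ge0 x) (ltW ll').
move: (rnorm x) (rnorm _) (rnorm _) (`|_|) => p q r s; nra.
Qed.

End SelfAdjoint.

(** * The cyclicity space *)

Section Subspaces.
Variables (R : realType) (H : completeNormedModType R[i]).
Variables (ip : {dot H for conjC}) (ip_norm : norm_of_ip ip).
Implicit Types (x y u v w : H) (a b z : R[i]) (G : set (H * H)) (N V : set H).

Lemma closed_subspaceT : closed_subspace [set: H].
Proof. by []. Qed.

Lemma adherent_subspace V : V 0 ->
  (forall a x y, V x -> V y -> V (a *: x + y)) -> closed_subspace (adherent V).
Proof.
move=> V0 Vlin; split.
- by move=> e e0; exists 0; rewrite ?subrr ?rnorm0.
- move=> a x y aVx aVy e e0.
  have K0 : 0 < 1 + Normc.normc a by rewrite ltr_pwDl// normc_ge0.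
  have d0 : 0 < e / (1 + Normc.normc a) by rewrite divr_gt0.
  have [x' Vx' xx'] := aVx _ d0; have [y' Vy' yy'] := aVy _ d0.
  exists (a *: x' + y'); first exact: Vlin.
  rewrite opprD addrACA -scalerBr; apply: le_lt_trans (rnormD _ _) _.
  have -> : e = Normc.normc a * (e / (1 + Normc.normc a)) + e / (1 + Normc.normc a).
    by field; rewrite gt_eqF.
  by rewrite rnormZ ler_ltD// ler_wpM2l ?normc_ge0// ltW.
- move=> x aax e e0; have e2 : 0 < e / 2 by rewrite divr_gt0.
  have [y /(_ _ e2)[v Vv yv] xy] := aax _ e2; exists v => //.
  by rewrite (le_lt_trans (rnorm_triangle y _ _))// [ltRHS]splitr ltrD.
Qed.

Lemma lin_span_comb V a x y : lin_span V x -> lin_span V y -> lin_span V (a *: x + y).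
Proof.
move=> [n [c [e [Ve ->]]]] [m [d [f [Vf ->]]]].
exists (n + m)%N, (fun i => match fintype.split i with inl j => a * c j | inr k => d k end),
  (fun i => match fintype.split i with inl j => e j | inr k => f k end); split.
  by move=> i; case: splitP.
rewrite big_split_ord /= scaler_sumr; congr (_ + _); apply: eq_bigr => i _.
  by rewrite -[lshift _ _]/(unsplit (inl i)) unsplitK scalerA.
by rewrite -[rshift _ _]/(unsplit (inr i)) unsplitK.
Qed.

Lemma lin_span0 V : lin_span V 0.
Proof.
exists 0%N, (fun=> 0), (fun=> 0); split; first by case.
by rewrite big_ord0.
Qed.

Lemma nonreal_Im z : (z \isn't Num.real) = (complex.Im z != 0).
Proof. by case: z => p q; rewrite complex_real. Qed.

Lemma cyclicity_closed G u : closed_subspace (cyclicity_space G u).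
Proof.
rewrite (_ : cyclicity_space G u = adherent (lin_span
    [set x | exists2 z, z \isn't Num.real & op_inv (op_shift G z) (u, x)])).
  by apply: adherent_subspace; [exact: lin_span0|exact: lin_span_comb].
by apply/seteqP; split => x /closure_adherent.
Qed.

Lemma cyclicity_gen G u z x : complex.Im z != 0 -> G (x, u + z *: x) ->
  cyclicity_space G u x.
Proof.
move=> z0 Gx; apply: subset_closure; exists 1%N, (fun=> 1), (fun=> x); split.
  move=> _ /=; exists z; first by rewrite nonreal_Im.
  by exists (x, u + z *: x) => //=; rewrite addrK.
by rewrite big_ord1 scale1r.
Qed.

Lemma cyclicity_min G u N : closed_subspace N ->
  (forall z x, complex.Im z != 0 -> G (x, u + z *: x) -> N x) ->
  cyclicity_space G u `<=` N.
Proof.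
move=> Nc gen x /closure_adherent aVx; have [N0 Nl Na] := Nc.
apply: Na => e e0; have [_ [n [c [f [Vf ->]]]] xv] := aVx _ e0.
exists (\sum_(i < n) c i *: f i) => //.
elim/big_ind: _ => // [y y' Ny Ny'|i _]; first exact: subspaceD.
apply: subspaceZ => //; have [z] := Vf i; rewrite nonreal_Im => z0.
move=> [[p q] /= Gpq [<- h]]; apply: (gen z) => //.
by rewrite -h subrK.
Qed.

Definition resolvent_invariant G N z :=
  forall v x, N v -> G (x, v + z *: x) -> N x.

Lemma resolvent_sub G z v v' x x' : linear_operator G ->
  G (x, v + z *: x) -> G (x', v' + z *: x') -> G (x - x', (v - v') + z *: (x - x')).
Proof. by move=> Gl h h'; rewrite scalerBr addrACA -opprD; exact: opB. Qed.

(* first resolvent identity *)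
Lemma resolvent_id G z z' v x x' : linear_operator G ->
  G (x, v + z *: x) -> G (x', v + z' *: x') ->
  G (x - x', (z - z') *: x' + z *: (x - x')).
Proof.
move=> Gl h h'; have := opB Gl h h'; congr (G (_, _)).
rewrite scalerBr scalerBl opprD addrACA subrr add0r.
by rewrite [RHS]addrC addrA subrK.
Qed.

Section FullOperator.
Variables (G : set (H * H)) (Gsa : selfadjoint_on ip setT G).

Let Gl : linear_operator G. Proof. by have [[]] := Gsa. Qed.
Let Gs : symmetric_operator ip G. Proof. by have [[]] := Gsa. Qed.

Let res z v : complex.Im z != 0 -> exists x, G (x, v + z *: x).
Proof.
by move=> z0; exact: (selfadjoint_resolvent ip_norm closed_subspaceT Gsa z0).
Qed.

Let inj z x x' v : complex.Im z != 0 ->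
  G (x, v + z *: x) -> G (x', v + z *: x') -> x = x'.
Proof. by move=> z0; exact: (symmetric_inj ip_norm Gl Gs). Qed.

(** By the resolvent identity the generator at [z'] is mapped to a difference
    quotient of generators; the case [z' = z] is a limit of the others. *)
Lemma cyclicity_invariant u z : complex.Im z != 0 ->
  resolvent_invariant G (cyclicity_space G u) z.
Proof.
move=> z0 v x Mv; move: v Mv x; set M := cyclicity_space G u.
have Mc := cyclicity_closed G u; have [M0 Ml Ma] := Mc.
have Z0 : 0 < `|complex.Im z| by rewrite normr_gt0.
suff : M `<=` [set v | forall x, G (x, v + z *: x) -> M x] by [].
rewrite {1}/M; apply: cyclicity_min.
  split.
  - move=> x Gx; rewrite (_ : x = 0)//; apply: (inj z0 Gx).
    by rewrite scaler0 addr0; case: Gl.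
  - move=> a v v' Nv Nv' x Gx; have [y Gy] := res v z0; have [y' Gy'] := res v' z0.
    rewrite (_ : x = a *: y + y'); first by apply: Ml; [exact: Nv|exact: Nv'].
    apply: (inj z0 Gx); have := opD Gl (opZ a Gl Gy) Gy'; congr (G (_, _)).
    rewrite !scalerDr addrACA; congr (_ + (_ + _)).
    by rewrite !scalerA mulrC.
  - move=> v av x Gx; apply: Ma => e e0.
    have [v' Nv' vv'] := av (`|complex.Im z| * e) (mulr_gt0 Z0 e0).
    have [x' Gx'] := res v' z0; exists x'; first exact: Nv'.
    rewrite -(ltr_pM2l Z0); apply: le_lt_trans vv'.
    by apply: (symmetric_lower ip_norm Gs); exact: (resolvent_sub Gl).
move=> z' y z'0 Gy x Gx.
have My := cyclicity_gen z'0 Gy.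
have [zz'|zz'] := eqVneq z z'; last first.
  have [y0 Gy0] := res u z0.
  have zz0 : z - z' != 0 by rewrite subr_eq0.
  rewrite (_ : x = (z - z')^-1 *: (y0 - y)); last first.
    apply: (inj z0 Gx); have := opZ (z - z')^-1 Gl (resolvent_id Gl Gy0 Gy).
    congr (G (_, _)); rewrite scalerDr; congr (_ + _).
      by rewrite scalerA mulVf// scale1r.
    by rewrite !scalerA mulrC.
  apply: (subspaceZ _ Mc); apply: (subspaceB Mc) => //; exact: cyclicity_gen Gy0.
subst z'; apply: Ma => e e0.
set d := `|complex.Im z| in Z0.
(* the shift [t] is real, so that [z + t] is as far from the real line as [z] *)
pose t := e * d ^+ 2 / (rnorm y + 1).
have K0 : 0 < rnorm y + 1 by rewrite ltr_wpDl ?rnorm_ge0.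
have t0 : 0 < t by rewrite divr_gt0 ?mulr_gt0 ?exprn_gt0.
have tC : t%:C != 0 :> R[i] by apply/eqP => /complexI tt; rewrite tt ltxx in t0.
have Imt : complex.Im (z + t%:C) = complex.Im z by case: (z) => ? ? /=; rewrite addr0.
have zt0 : complex.Im (z + t%:C) != 0 by rewrite Imt.
have [y1 Gy1] := res u zt0.
exists (t%:C^-1 *: (y1 - y)).
  apply: (subspaceZ _ Mc); apply: (subspaceB Mc) => //; exact: cyclicity_gen Gy1.
have h1 : G (t%:C^-1 *: (y1 - y), y + (z + t%:C) *: (t%:C^-1 *: (y1 - y))).
  have := opZ t%:C^-1 Gl (resolvent_id Gl Gy1 Gy); congr (G (_, _)).
  rewrite [z + _]addrC addrK scalerDr scalerA mulVf// scale1r; congr (_ + _).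
  by rewrite !scalerA mulrC.
have b1 : d * rnorm (t%:C^-1 *: (y1 - y)) <= rnorm y.
  by rewrite /d -Imt; exact: (symmetric_lower ip_norm Gs).
have h2 : G (x - t%:C^-1 *: (y1 - y), (y - y1) + z *: (x - t%:C^-1 *: (y1 - y))).
  apply: (resolvent_sub Gl) => //; move: h1; congr (G (_, _)).
  rewrite scalerDl addrCA addrC; congr (_ + _).
  by rewrite scalerA mulfV// scale1r addrC subrK.
have b2 := symmetric_lower ip_norm Gs h2.
rewrite -(ltr_pM2l Z0); apply: le_lt_trans b2 _.
have -> : rnorm (y - y1) = t * rnorm (t%:C^-1 *: (y1 - y)).
  by rewrite -{1}(gtr0_norm t0) -rnormZr scalerA mulfV// scale1r rnormB.
rewrite -(ltr_pM2l Z0) mulrCA; apply: le_lt_trans (ler_wpM2l (ltW t0) b1) _.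
rewrite /t mulrAC ltr_pdivrMr// (_ : d * (d * e) = e * d ^+ 2); last by ring.
by rewrite ltr_pM2l ?mulr_gt0 ?exprn_gt0// ltrDl.
Qed.

(** [- z (G - z)^-1 u] tends to [u] as [z] tends to infinity along the imaginary
    axis. *)
Lemma cyclicity_mem u : densely_defined G -> cyclicity_space G u u.
Proof.
move=> Gd; have [_ _ Ma] := cyclicity_closed G u.
apply: Ma => e e0; have e4 : 0 < e / 4 by rewrite divr_gt0.
have [x [y Gxy] ux] : exists2 x, (exists y, G (x, y)) & rnorm (u - x) < e / 4.
  have [|x [bx [[x' y] Gxy /= xx']]] := Gd (ball u (e / 4)%:C) _ (ball_open _ _).
    by exists u; apply: ballxx; rewrite ltcR.
  move: bx; rewrite ball_rnorm /= => bx; exists x => //; exists y.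
  by rewrite -xx'.
pose k := 1 + rnorm y * 4 / e.
have k0 : 0 < k by rewrite ltr_pwDl// divr_ge0 ?mulr_ge0 ?rnorm_ge0 ?(ltW e0).
have kC : k%:C != 0 :> R[i] by apply/eqP => /complexI tt; rewrite tt ltxx in k0.
pose z : R[i] := 'i%R * k%:C.
have Imz : complex.Im z = k by rewrite /z -complexiE /= mul0r mul1r add0r.
have nz : Normc.normc z = k.
  by rewrite /z -complexiE /= !mul0r !mul1r subr0 expr0n add0r sqrtr_sqr gtr0_norm ?addr0 ?add0r.
have z0 : complex.Im z != 0 by rewrite Imz gt_eqF.
have zn0 : z != 0 by apply/eqP => zz; move: z0; rewrite zz eqxx.
have [r Gr] := res u z0.
exists (- (z *: r)).
  by rewrite -scaleNr; apply: (subspaceZ _ (cyclicity_closed G u)); exact: cyclicity_gen Gr.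
have h : G (r + z^-1 *: x, ((u - x) + z^-1 *: y) + z *: (r + z^-1 *: x)).
  have := opD Gl Gr (opZ z^-1 Gl Gxy); congr (G (_, _)).
  rewrite scalerDr [z *: (_ *: _)]scalerA mulfV// scale1r.
  by rewrite (addrC (z *: r) x) [RHS]addrACA subrK [in RHS](addrC _ (z *: r)) addrA.
have := symmetric_lower ip_norm Gs h.
rewrite Imz gtr0_norm//.
have -> : k * rnorm (r + z^-1 *: x) = rnorm (z *: r + x).
  by rewrite -nz -rnormZ scalerDr scalerA mulfV// scale1r.
move=> h1; rewrite opprK.
apply: (@le_lt_trans _ _ (rnorm (u - x) + rnorm (z *: r + x))).
  have -> : u + z *: r = (u - x) + (z *: r + x) by rewrite (addrC (z *: r)) addrA subrK.
  exact: rnormD.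
have h2 := rnormD (u - x) (z^-1 *: y).
have : rnorm (z^-1 *: y) <= e / 4.
  rewrite rnormZ Normc.normcV nz ler_pdivrMl// /k mulrDl mul1r.
  have -> : rnorm y * 4 / e * (e / 4) = rnorm y by field; rewrite gt_eqF.
  by rewrite lerDr ltW.
lra.
Qed.

End FullOperator.

End Subspaces.

(** * Reducing subspaces and the extensions *)

Section Reduction.
Variables (R : realType) (H : completeNormedModType R[i]).
Variables (ip : {dot H for conjC}) (ip_norm : norm_of_ip ip).
Implicit Types (x y u v : H) (a c z : R[i]) (G : set (H * H)) (N V : set H).

Lemma nonreal_i : complex.Im ('i%R : R[i]) != 0.
Proof. by rewrite Im_i oner_eq0. Qed.

Lemma nonreal_Ni : complex.Im (- 'i%R : R[i]) != 0.
Proof. by rewrite -complexiE /= oppr_eq0 oner_eq0. Qed.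

(** That [G] maps [N] to itself is the point. Write [(G + i) x = v1 + (v - v1)]
    with [v1] in [N] and [v - v1] orthogonal to it. The solution [x - x1] for the
    right-hand side [v - v1] lies in [N], by invariance, and is orthogonal to [N],
    because [N] is invariant under the adjoint resolvent; so it vanishes. *)
Lemma selfadjoint_restrict G N : selfadjoint_on ip setT G -> closed_subspace N ->
  resolvent_invariant G N 'i%R -> resolvent_invariant G N (- 'i%R) ->
  selfadjoint_on ip N (op_restrict G N).
Proof.
move=> Gsa Nc Ni Nmi; have [[Gl Gs] _ Gi Gmi] := Gsa; have [N0 Nl Na] := Nc.
split.
- split.
    split.
    + by split => //; case: Gl.
    + move=> a [x y] [x' y'] [/= Gx Nx] [/= Gx' Nx']; split => /=; last exact: Nl.
      by have [_ Gc _] := Gl; exact: (Gc a (x, y) (x', y')).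
    + by move=> x y y' [/= h _] [/= h' _]; case: Gl => _ _ Gf; exact: Gf h h'.
  by move=> p q [Gp _] [Gq _]; exact: Gs.
- move=> x y [/= Gx Nx]; split => //.
  pose v := y + 'i%R *: x.
  have Gv : G (x, v + - 'i%R *: x) by rewrite scaleNr addrK.
  have [v1 av1 perp] := projection ip_norm N0 Nl v.
  have Nv1 : N v1 by exact: Na.
  have [x1] := Gmi v1 I; rewrite -scaleNr => Gx1.
  have Nx1 : N x1 by exact: Nmi Gx1.
  have Gd := resolvent_sub Gl Gv Gx1.
  have [n Gn] := Gi (x - x1) I.
  have Nn : N n by apply: Ni Gn; exact: subspaceB.
  have xx1 : x - x1 = 0.
    apply: rnorm_eq0; apply/eqP; rewrite -sqrf_eq0; apply/eqP; apply: complexI.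
    rewrite -(ip_self ip_norm); have := Gs _ _ Gd Gn; move: (x - x1) => d /=.
    rewrite (ipDl _ (v - v1)) (ipDr _ d) !ipZl !ipZr conjc_i.
    by rewrite (ipC _ (v - v1)) perp// conjc0 add0r => /eqP; rewrite -subr_eq addrN eq_sym => /eqP.
  have vv1 : v = v1.
    apply/eqP; rewrite -subr_eq0; apply/eqP.
    have [G0 _ Gf] := Gl; move: Gd; rewrite xx1 scaler0 addr0 => Gd.
    exact: Gf Gd G0.
  have -> : y = v - 'i%R *: x by rewrite addrK.
  by apply: subspaceB => //; [rewrite vv1|exact: subspaceZ].
- by move=> v Nv; have [x Gx] := Gi v I; exists x; split => //=; exact: Ni Gx.
- move=> v Nv; have [x Gx] := Gmi v I; exists x; split => //=; apply: Nmi Nv _.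
  by rewrite scaleNr.
Qed.

End Reduction.

Section Extensions.
Variables (R : realType) (H : completeNormedModType R[i]).
Variables (ip : {dot H for conjC}) (ip_norm : norm_of_ip ip).
Variables (B : set (H * H)) (B_lin : linear_operator B).
Hypotheses (B_dense : densely_defined B) (B_closed : closed_operator B).
Hypotheses (B_sym : symmetric_operator ip B) (B_def : deficiency_indices ip B 1 1).
Variables up um : H.
Hypotheses (up_K : Kplus ip B up) (up_unit : `|up| = 1).
Hypotheses (um_K : Kminus ip B um) (um_unit : `|um| = 1).
Implicit Types (x y u v b d : H) (a c z w : R[i]).

Lemma ip_up_self : ip up up = 1.
Proof. by rewrite -ip_norm up_unit expr1n. Qed.

Lemma ip_um_self : ip um um = 1.
Proof. by rewrite -ip_norm um_unit expr1n. Qed.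

Lemma ip_up b d : B (b, d) -> ip d up = - 'i%R * ip b up.
Proof.
move=> Bbd; have := up_K (v := d + 'i%R *: b) _.
have h : op_ran (op_shift B (- 'i%R)) (d + 'i%R *: b).
  by exists (b, d + 'i%R *: b) => //; exists (b, d) => //=; rewrite scaleNr opprK.
by move=> /(_ h); rewrite ipDl ipZl => /eqP; rewrite addr_eq0 mulNr => /eqP.
Qed.

Lemma ip_um b d : B (b, d) -> ip d um = 'i%R * ip b um.
Proof.
move=> Bbd; have := um_K (v := d - 'i%R *: b) _.
have h : op_ran (op_shift B 'i%R) (d - 'i%R *: b).
  by exists (b, d - 'i%R *: b) => //; exists (b, d).
by move=> /(_ h); rewrite ipDl ipNl ipZl => /eqP; rewrite subr_eq0 => /eqP.
Qed.

(** Green's formula: the boundary form of the adjoint of [B] on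
    [D(B) + span(up) + span(um)], the adjoint acting by [i] on [up] and by [-i]
    on [um]. *)
Lemma green b d a c b' d' a' c' : B (b, d) -> B (b', d') ->
  ip (d + (a * 'i%R) *: up - (c * 'i%R) *: um) (b' + a' *: up + c' *: um) =
  ip (b + a *: up + c *: um) (d' + (a' * 'i%R) *: up - (c' * 'i%R) *: um)
  + 2 * 'i%R * (a * conjc a' - c * conjc c').
Proof.
move=> Bb Bb'; have /= hs := B_sym Bb Bb'.
rewrite !ipE hs (ip_up Bb) (ip_um Bb) (ipC _ up d') (ipC _ um d').
rewrite (ip_up Bb') (ip_um Bb') ip_up_self ip_um_self.
rewrite !conjcM !conjcN !conjc_i (ipC _ up b') (ipC _ um b') (ipC _ um up) /=.
by ring.
Qed.

(** [T_ext] with an arbitrary complex number [w] in place of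
    [exp (- 2 i theta)]. *)
Definition ext w : set (H * H) :=
  [set p | exists q a, B q /\
     p = (q.1 + a *: up + (a * w) *: um,
          q.2 + (a * 'i%R) *: up - (a * 'i%R * w) *: um)].

Lemma ext_sub w : B `<=` ext w.
Proof.
move=> [b d] Bbd; exists (b, d), 0; split => //=.
by rewrite !mul0r !scale0r !addr0 subr0.
Qed.

Lemma ext_dense w : densely_defined (ext w).
Proof.
move=> O O0 Oo; have [x [Ox [[b d] Bbd /= bx]]] := B_dense O0 Oo.
by exists x; split => //; exists (b, d) => //; exact: ext_sub.
Qed.

Lemma ext_symmetric w : w * conjc w = 1 -> symmetric_operator ip (ext w).
Proof.
move=> w1 _ _ [[b d] [a [/= Bb ->]]] [[b' d'] [a' [/= Bb' ->]]] /=.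
have := green a (a * w) a' (a' * w) Bb Bb'.
rewrite mulrAC (mulrAC a') => ->; rewrite conjcM.
have -> : a * conjc a' - a * w * (conjc a' * conjc w) =
   a * conjc a' * (1 - w * conjc w) by ring.
by rewrite w1 subrr !mulr0 addr0.
Qed.

Lemma dense_perp G v : densely_defined G ->
  (forall x y, G (x, y) -> ip v x = 0) -> v = 0.
Proof.
move=> Gd h; apply: rnorm_eq0; apply/eqP; rewrite -sqrf_eq0; apply/eqP.
apply: complexI; rewrite -(ip_self ip_norm).
apply: (@small_eq0 _ _ (rnorm v)) => e e0.
have [|x [bx [[x' y] Gxy /= xx']]] := Gd (ball v e%:C) _ (ball_open _ _).
  by exists v; apply: ballxx; rewrite ltcR.
move: bx; rewrite ball_rnorm /= => bx.
have -> : ip v v = ip v (v - x).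
  by rewrite ipDr ipNr -xx' (h _ _ Gxy) subr0.
apply: le_trans (ip_le ip_norm _ _) _.
by rewrite ler_wpM2l ?rnorm_ge0// ltW.
Qed.

Lemma ext_linear w : w * conjc w = 1 -> linear_operator (ext w).
Proof.
move=> w1.
have comb a p q : ext w p -> ext w q -> ext w (a *: p.1 + q.1, a *: p.2 + q.2).
  move=> [[b d] [c [/= Bb ->]]] [[b' d'] [c' [/= Bb' ->]]] /=.
  exists (a *: b + b', a *: d + d'), (a * c + c'); split.
    by case: B_lin => _ + _ => /(_ a _ _ Bb Bb').
  rewrite /= !scalerDr !mulrDl !scalerDl scalerN opprD !scalerA !mulrA.
  by congr (_, _); rewrite addrACA [in X in X + _ = _]addrACA.
have ext0 : ext w (0, 0) by apply: ext_sub; case: B_lin.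
split => // x y y' h h'; apply/eqP; rewrite -subr_eq0; apply/eqP.
have := comb (-1) _ _ h' h; rewrite /= !scaleN1r addNr addrC => hd.
apply: (dense_perp B_dense) => b d /(@ext_sub w) Bb.
by have := ext_symmetric w1 hd Bb; rewrite /= ip0l.
Qed.

Lemma one_dim_span V u v : has_dim V 1 -> V u -> ip u u = 1 -> V v ->
  exists c, v = c *: u.
Proof.
move=> [e [_ ->]] Vu u1 Vv.
have sp x : lin_span (range e) x -> exists c, x = c *: e ord0.
  move=> [n [c [f [fe ->]]]]; exists (\sum_i c i).
  rewrite scaler_suml; apply: eq_bigr => i _; have [j _ <-] := fe i.
  by rewrite ord1.
have [[c0 uc] [c ->]] := (sp _ Vu, sp _ Vv); exists (c / c0).
rewrite uc scalerA mulfVK//; apply/eqP => c00.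
by have := u1; rewrite uc c00 scale0r ip0l => /eqP; rewrite eq_sym oner_eq0.
Qed.

Lemma Kplus_span v : Kplus ip B v -> exists c, v = c *: up.
Proof. by apply: one_dim_span => //; [case: B_def|exact: ip_up_self]. Qed.

Lemma Kminus_span v : Kminus ip B v -> exists c, v = c *: um.
Proof. by apply: one_dim_span => //; [case: B_def|exact: ip_um_self]. Qed.

(** The range of [B - z] is closed because [B] is, so the orthogonal projection
    onto it is attained. *)
Lemma range_decomposition z v : complex.Im z != 0 ->
  exists b d, B (b, d) /\ orthocompl ip (op_ran (op_shift B z)) (v - (d - z *: b)).
Proof.
move=> z0.
pose V := [set u | exists x, B (x, u + z *: x)].
have [||p aVp perp] := projection ip_norm (V := V) _ _ v.
- by exists 0; rewrite scaler0 addr0; case: B_lin.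
- move=> a u u' [x Bx] [x' Bx']; exists (a *: x + x').
  have := opD B_lin (opZ a B_lin Bx) Bx'; congr (B (_, _)).
  by rewrite !scalerDr addrACA; congr (_ + (_ + _)); rewrite !scalerA mulrC.
have [b Bb] : V p.
  apply: (closed_range B_lin _ (c := `|complex.Im z|)) aVp.
  - by move=> x y; exact: (closed_pairP (p := (x, y)) B_closed).
  - by rewrite normr_gt0.
  - by move=> x u; exact: symmetric_lower.
exists b, (p + z *: b); rewrite addrK; split => //.
move=> _ [[x u] [[x' y] /= Bxy [_ <-]] <-] /=; apply: perp.
by exists x'; rewrite subrK.
Qed.

(** [Ran (B -+ i)] misses only the span of one deficiency vector, and that one is
    reached from the vector [up + w um] adjoined to the domain. *)
Lemma ext_selfadjoint w : w * conjc w = 1 -> selfadjoint_on ip setT (ext w).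
Proof.
move=> w1; have i0 : 'i%R != 0 :> R[i] by rewrite neq0Ci.
have w0 : w != 0.
  by apply/eqP => ww; move: w1; rewrite ww mul0r => /eqP; rewrite eq_sym oner_eq0.
split => //.
- by split; [exact: ext_linear|exact: ext_symmetric].
- move=> v _.
  have [b [d [Bb /Kminus_span[c vc]]]] := range_decomposition v (nonreal_i R).
  (* [(ext w - i) (up + w um) = - 2 i w um] *)
  pose a := - c / (2 * 'i%R * w).
  exists (b + a *: up + (a * w) *: um), (b, d), a; split => //=; congr (_, _).
  have -> : v = (d - 'i%R *: b) + c *: um by rewrite -vc addrC subrK.
  rewrite !scalerDr addrACA [d - _ + _]addrA subrK !scalerA -scalerDl -scaleNr.
  congr (_ + _ *: _ + _ *: _); first by rewrite mulrC.
  by rewrite /a; field; rewrite w0 i0.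
- move=> v _.
  have [b [d [Bb /Kplus_span[c vc]]]] := range_decomposition v (nonreal_Ni R).
  (* [(ext w + i) (up + w um) = 2 i up] *)
  pose a := c / (2 * 'i%R).
  exists (b + a *: up + (a * w) *: um), (b, d), a; split => //=; congr (_, _).
  have -> : v = (d - - 'i%R *: b) + c *: up by rewrite -vc addrC subrK.
  rewrite -[- ('i%R *: (_ + _))]scaleNr !scalerDr [_ + c *: up + _]addrA addrACA subrK !scalerA.
  rewrite -scalerDl -scaleNr.
  congr (_ + _ *: _ + _ *: _); last by ring.
  by rewrite /a; field; rewrite i0.
Qed.

Lemma deficiency_up_sol w : w * conjc w = 1 ->
  ext w ((2 * 'i%R)^-1 *: (up + w *: um),
         up - 'i%R *: ((2 * 'i%R)^-1 *: (up + w *: um))).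
Proof.
move=> w1; have i0 : 'i%R != 0 :> R[i] by rewrite neq0Ci.
exists (0, 0), ((2 * 'i%R)^-1); split; first by case: B_lin.
rewrite /= !add0r scalerDr !scalerA; congr (_, _).
rewrite scalerDr opprD !scalerA addrA -[X in X - _ *: up]scale1r -scalerBl.
by congr (_ *: _ - _ *: _); field; rewrite i0.
Qed.

(** Both extensions are restrictions of the adjoint of [B], so [x - x'] lies in
    its eigenspace [K_+]. *)
Lemma resolvent_diff_p w w' v x x' : w * conjc w = 1 -> w' * conjc w' = 1 ->
  ext w (x, v + 'i%R *: x) -> ext w' (x', v + 'i%R *: x') ->
  exists c, x - x' = c *: up.
Proof.
move=> w1 w1' h h'; apply: Kplus_span => _ [[b u] [[b' d] /= Bb [_ <-]] <-] /=.
have := ext_symmetric w1 (ext_sub w Bb) h; have := ext_symmetric w1' (ext_sub w' Bb) h'.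
rewrite /= scaleNr opprK !ipE conjc_i => -> ->.
ring.
Qed.

Lemma resolvent_diff_m w w' v x x' : w * conjc w = 1 -> w' * conjc w' = 1 ->
  ext w (x, v + - 'i%R *: x) -> ext w' (x', v + - 'i%R *: x') ->
  exists c, x - x' = c *: um.
Proof.
move=> w1 w1' h h'; apply: Kminus_span => _ [[b u] [[b' d] /= Bb [_ <-]] <-] /=.
have := ext_symmetric w1 (ext_sub w Bb) h; have := ext_symmetric w1' (ext_sub w' Bb) h'.
rewrite /= !ipE conjcN conjc_i => -> ->. rewrite complexiE; ring.
Qed.

Definition ext_invariant w N :=
  resolvent_invariant (ext w) N 'i%R /\ resolvent_invariant (ext w) N (- 'i%R).

Lemma ext_solve w z v : w * conjc w = 1 -> complex.Im z != 0 ->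
  exists x, ext w (x, v + z *: x).
Proof.
by move=> w1 z0; exact: (selfadjoint_resolvent ip_norm (@closed_subspaceT _ H) (ext_selfadjoint w1) z0).
Qed.

Lemma ext_invariant_change w w' N : w * conjc w = 1 -> w' * conjc w' = 1 ->
  closed_subspace N -> N up -> N um -> ext_invariant w N -> ext_invariant w' N.
Proof.
move=> w1 w1' Nc Nup Num [Ni Nmi]; split=> v x' Nv h'.
  have [x h] := ext_solve v w1 (nonreal_i R).
  have [c xx] := resolvent_diff_p w1' w1 h' h.
  rewrite -(subrK x x') xx; apply: subspaceD => //; first exact: subspaceZ.
  exact: Ni h.
have [x h] := ext_solve v w1 (nonreal_Ni R).
have [c xx] := resolvent_diff_m w1' w1 h' h.
rewrite -(subrK x x') xx; apply: subspaceD => //; first exact: subspaceZ.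
exact: Nmi h.
Qed.

(** [up + w um] is a multiple of the resolvent at [- i] applied to [up]. *)
Lemma um_mem w N : w * conjc w = 1 -> closed_subspace N -> N up ->
  ext_invariant w N -> N um.
Proof.
move=> w1 Nc Nup [_ Nmi]; have i0 : 'i%R != 0 :> R[i] by rewrite neq0Ci.
have w0 : w != 0.
  by apply/eqP => ww; move: w1; rewrite ww mul0r => /eqP; rewrite eq_sym oner_eq0.
have := deficiency_up_sol w1; rewrite -scaleNr => /(Nmi _ _ Nup) h.
have h2 := subspaceZ (2 * 'i%R) Nc h.
rewrite scalerA mulfV ?scale1r ?mulf_neq0// ?pnatr_eq0// in h2.
have := subspaceZ w^-1 Nc (subspaceB Nc h2 Nup).
by rewrite addrC addKr scalerA mulVf// scale1r.
Qed.

Variable w1 : R[i].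
Hypothesis w1u : w1 * conjc w1 = 1.

Let M := cyclicity_space (ext w1) up.

Lemma M_closed : closed_subspace M.
Proof. exact: cyclicity_closed. Qed.

Lemma M_up : M up.
Proof.
exact: (cyclicity_mem ip_norm (ext_selfadjoint w1u) (@ext_dense w1)).
Qed.

Lemma M_invariant1 : ext_invariant w1 M.
Proof.
by split; apply: (cyclicity_invariant ip_norm (ext_selfadjoint w1u));
  [exact: nonreal_i|exact: nonreal_Ni].
Qed.

Lemma M_um : M um.
Proof. exact: (um_mem w1u M_closed M_up M_invariant1). Qed.

Lemma M_invariant w : w * conjc w = 1 -> ext_invariant w M.
Proof.
move=> wu.
exact: (ext_invariant_change w1u wu M_closed M_up M_um M_invariant1).
Qed.

Lemma M_selfadjoint w : w * conjc w = 1 ->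
  selfadjoint_on ip M (op_restrict (ext w) M).
Proof.
move=> wu; have [Mi Mmi] := M_invariant wu.
exact: (selfadjoint_restrict ip_norm (ext_selfadjoint wu) M_closed Mi Mmi).
Qed.

(** Hence [M] does not depend on the extension used to define it. A closed
    subspace invariant at [+-i] reduces [ext w1], so it is invariant under all its
    resolvents. *)
Lemma M_min w N : w * conjc w = 1 -> closed_subspace N -> N up ->
  ext_invariant w N -> M `<=` N.
Proof.
move=> wu Nc Nup Ninv.
have [Ni Nmi] := ext_invariant_change wu w1u Nc Nup (um_mem wu Nc Nup Ninv) Ninv.
have Nsa := selfadjoint_restrict ip_norm (ext_selfadjoint w1u) Nc Ni Nmi.
apply: cyclicity_min => // z x z0 Gx.
have [x' [/= Gx' Nx']] := selfadjoint_resolvent ip_norm Nc Nsa z0 Nup.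
suff -> : x = x' by [].
exact: (symmetric_inj ip_norm (ext_linear w1u) (ext_symmetric w1u) z0 Gx Gx').
Qed.

(** Such an [x] is orthogonal to [up], hence to all resolvents applied to [up],
    hence to [M]. *)
Lemma B_no_eigenvector (l : R) x : M x -> B (x, l%:C *: x) -> x = 0.
Proof.
move=> Mx Bx.
have xup : ip x up = 0.
  have /eqP := ip_up Bx; rewrite ipZl -subr_eq0 -mulrBl mulf_eq0.
  move=> /orP[/eqP/(congr1 (@complex.Im R)) h|/eqP//]; exfalso; move: h.
  by rewrite -complexiE /=; lra.
have Nc : closed_subspace [set y | ip x y = 0].
  split => [|a y y' /= h h'|y ay] /=.
  - exact: ip0r.
  - by rewrite ipDr ipZr h h' mulr0 addr0.
  - apply: (@small_eq0 _ _ (rnorm x)) => e e0; have [y' h yy'] := ay _ e0.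
    have -> : ip x y = ip x (y - y') by rewrite ipDr ipNr h subr0.
    by apply: le_trans (ip_le ip_norm _ _) _; rewrite ler_wpM2l ?rnorm_ge0// ltW.
have : ip x x = 0.
  apply: (cyclicity_min (u := up) Nc _ Mx) => z y z0 Gy /=.
  have := ext_symmetric w1u (ext_sub w1 Bx) Gy.
  rewrite /= ipZl ipDr ipZr xup add0r => /eqP.
  rewrite -subr_eq0 -mulrBl mulf_eq0 => /orP[|/eqP//].
  move=> /eqP/(congr1 (@complex.Im R)); case: z z0 {Gy} => p q /= q0.
  by rewrite sub0r opprK => qq; rewrite qq eqxx in q0.
rewrite (ip_self ip_norm) => /complexI/eqP; rewrite expf_eq0 /= => /eqP.
exact: rnorm_eq0.
Qed.

(** The second condition says that [x] has components [1] on [up] and [w] on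
    [um], and that the adjoint of [B] multiplies it by [l]. *)
Definition eigenvec (l : R) w x :=
  M x /\ B (x - up - w *: um, l%:C *: x - 'i%R *: up + ('i%R * w) *: um).

Lemma eigenvec_ext l w x : eigenvec l w x -> ext w (x, l%:C *: x).
Proof.
move=> [_ Bx]; exists (x - up - w *: um, l%:C *: x - 'i%R *: up + ('i%R * w) *: um), 1.
split => //=; rewrite !mul1r scale1r.
by rewrite [x - _ - _]addrAC subrK subrK [_ - _ + _ + _]addrAC subrK addrK.
Qed.

(** Green's formula for two eigenvectors of the adjoint of [B]. *)
Lemma eigenvec_green l w x l' w' x' : eigenvec l w x -> eigenvec l' w' x' ->
  (l - l')%:C * ip x x' = 2 * 'i%R * (1 - w * conjc w').
Proof.
move=> [_ Bx] [_ Bx'].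
have := green 1 w 1 w' Bx Bx'; rewrite !mul1r conjc1 !scale1r.
have e1 t (v : H) : v - up - t *: um + up + t *: um = v.
  by rewrite [v - _ - _]addrAC subrK subrK.
have e2 t (v : H) : v - 'i%R *: up + ('i%R * t) *: um + 'i%R *: up - (t * 'i%R) *: um = v.
  by rewrite (mulrC t) [v - _ + _ + _]addrAC subrK addrK.
rewrite !e1 !e2 ipZl ipZr conjC_real rmorphB /= mulrBl => ->.
by rewrite addrAC subrr add0r.
Qed.

Lemma eigenvec_unit l w x : eigenvec l w x -> w * conjc w = 1.
Proof.
move=> h; have := eigenvec_green h h; rewrite subrr mul0r => /esym/eqP.
by rewrite !mulf_eq0 pnatr_eq0 (negPf (neq0Ci _)) /= subr_eq0 eq_sym => /eqP.
Qed.

Lemma addr2_cancel (p q r s : H) : (p + r + s) - (q + r + s) = p - q.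
Proof. by rewrite !opprD addrACA subrr addr0 addrACA subrr addr0. Qed.

(** The difference of the two would be an eigenvector of [B]. *)
Lemma eigenvec_unique l w x x' : eigenvec l w x -> eigenvec l w x' -> x = x'.
Proof.
move=> [Mx Bx] [Mx' Bx']; apply/eqP; rewrite -subr_eq0; apply/eqP.
apply: (B_no_eigenvector (l := l)); first exact: (subspaceB M_closed).
have := opB B_lin Bx Bx'; congr (B (_, _)).
  exact: addr2_cancel.
by rewrite addr2_cancel scalerBr.
Qed.

Lemma eigenvec_neq0 l w x : eigenvec l w x -> x != 0.
Proof.
move=> [_ Bx]; apply/eqP => x0; have := ip_up Bx; rewrite x0.
rewrite !ipE !ip0l ip_up_self; move: (ip um up) => s h.
have : 2 * 'i%R = 0 :> R[i].
  transitivity (- 'i%R * (0 - 1 - w * s) - (l%:C * 0 - 'i%R * 1 + 'i%R * w * s)).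
    ring.
  by rewrite h subrr.
by move/eqP; rewrite mulf_eq0 pnatr_eq0 (negPf (neq0Ci _)).
Qed.

(** * Bounded resolvents and spectral gaps *)

Section Gap.
Variables (w : R[i]) (wu : w * conjc w = 1).
Let A := op_restrict (ext w) M.

Let Asa : selfadjoint_on ip M A. Proof. exact: M_selfadjoint. Qed.
Let Al : linear_operator A. Proof. by have [[]] := Asa. Qed.
Let As : symmetric_operator ip A. Proof. by have [[]] := Asa. Qed.

Variables (l r C0 : R) (r0 : 0 < r).
Hypothesis up_bounded : forall s : R, l - r <= s <= l + r ->
  exists2 y, A (y, up + s%:C *: y) & rnorm y <= C0.

(* vectors whose images under the resolvent of [A] stay bounded along the interval *)
Let S v := M v /\ exists C : R, forall s : R, l - r <= s <= l + r ->
  exists2 y, A (y, v + s%:C *: y) & rnorm y <= C.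

Let S_lin a v v' : S v -> S v' -> S (a *: v + v').
Proof.
move=> [Mv [C vC]] [Mv' [C' vC']]; have [M0 Ml Ma] := M_closed.
split; first exact: Ml.
exists (Normc.normc a * C + C') => s /[dup] /vC[y Ay yC] /vC'[y' Ay' yC'].
exists (a *: y + y').
  have := opD Al (opZ a Al Ay) Ay'; congr (A (_, _)).
  by rewrite !scalerDr addrACA !scalerA (mulrC a).
by apply: le_trans (rnormD _ _) _; rewrite rnormZ lerD// ler_wpM2l ?normc_ge0.
Qed.

Let S_res v x (e : R[i]) : complex.Re e = 0 -> `|complex.Im e| = 1 ->
  S v -> ext w (x, v + e *: x) -> M x -> S x.
Proof.
move=> re ie [Mv [C vC]] Gx Mx; split => //; exists (C + rnorm x) => s /vC[y Ay yC].
have se : 1 <= Normc.normc (s%:C - e).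
  case: (e) re ie => p q /= p0 q1; rewrite p0 sub0r oppr0 addr0 sqrrN.
  rewrite -[leLHS]sqrtr1 ler_wsqrtr// -[q ^+ 2]real_normK ?num_real// q1 expr1n.
  by rewrite lerDr sqr_ge0.
have se0 : s%:C - e != 0.
  by apply/eqP => h; move: se; rewrite h Normc.normc0 leNgt ltr01.
(* resolvent identity; [|s - e|] is at least [1] *)
exists ((s%:C - e)^-1 *: (y - x)).
  have Ax : A (x, v + e *: x) by [].
  have := opZ (s%:C - e)^-1 Al (resolvent_id Al Ay Ax); congr (A (_, _)).
  rewrite scalerDr scalerA mulVf// scale1r; congr (_ + _).
  by rewrite !scalerA mulrC.
rewrite rnormZ Normc.normcV; apply: (@le_trans _ _ (rnorm (y - x))).
  by rewrite ler_piMl ?rnorm_ge0// invf_le1// (lt_le_trans ltr01).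
by apply: le_trans (rnormD _ _) _; rewrite rnormN lerD.
Qed.

Let S_dense : M `<=` adherent S.
Proof.
have [M0 Ml Ma] := M_closed.
have S0 : S 0.
  split => //; exists 0 => s _; exists 0; last by rewrite rnorm0.
  by rewrite scaler0 addr0; case: Al.
have [Mi Mmi] := M_invariant wu.
have SM : S `<=` M by move=> v [].
have aSM : adherent S `<=` M.
  by move=> v av; apply: Ma => e /av[v' /SM]; exists v'.
have Sc := adherent_subspace S0 S_lin.
have res (e : R[i]) : complex.Re e = 0 -> `|complex.Im e| = 1 ->
    resolvent_invariant (ext w) M e -> resolvent_invariant (ext w) (adherent S) e.
  move=> re ie Me v x av Gx t t0; have [v' Sv' vv'] := av _ t0.
  have e0 : complex.Im e != 0 by rewrite -normr_gt0 ie.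
  have [x' Gx'] := ext_solve v' wu e0; have Mx' : M x' by exact: Me (SM _ Sv') Gx'.
  exists x'; first exact: S_res Sv' Gx' Mx'.
  apply: le_lt_trans vv'.
  have := symmetric_lower ip_norm (ext_symmetric wu)
    (resolvent_sub (ext_linear wu) Gx Gx').
  by rewrite ie mul1r.
apply: (M_min wu Sc).
  move=> e e0; exists up; last by rewrite subrr rnorm0.
  by split; [exact: M_up|exists C0].
split; apply: res => //; rewrite -complexiE /= ?oppr0// ?normrN normr1//.
Qed.

(** The vectors of [M] with bounded resolvents contain [up] and are invariant
    under the resolvents of [A], so they are dense in [M]. The lower bound of
    [bounded_below_of_bounded_resolvent] holds for those in the domain of [A], and
    passes to the whole domain in the graph norm. *)
Lemma gap_resolvent_set : resolvent_set M A l%:C.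
Proof.
apply: (bounded_below_resolvent_set ip_norm M_closed Asa r0) => f f' Af.
apply/ler_addgt0Pr => e e0.
have Mf := M_closed.
have [Mff Mff'] : M f /\ M f' by case: Asa => _ + _ _; apply.
pose v := f' - 'i%R *: f.
have Mv : M v by apply: (subspaceB Mf) => //; exact: (subspaceZ _ Mf).
pose K := r + 1 + Normc.normc ('i%R - l%:C).
have K0 : 0 < K by rewrite /K ltr_wpDr ?normc_ge0// ltr_wpDl ?ltW.
have [v' Sv' vv'] := S_dense Mv (divr_gt0 e0 K0).
have [Mi Mmi] := M_invariant wu.
have [x' Gx'] := ext_solve v' wu (nonreal_i R).
have Mx' : M x' by apply: Mi Gx'; case: Sv'.
have [_ [C vC]] : S x'.
  by apply: S_res Sv' Gx' Mx'; rewrite -complexiE /= ?normr1.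
have Ax' : A (x', v' + 'i%R *: x') by [].
have low := bounded_below_of_bounded_resolvent ip_norm r0 Al As Ax' vC.
have Gf : ext w (f, v + 'i%R *: f) by rewrite subrK; case: Af.
have d1 : rnorm (f - x') <= rnorm (v - v').
  have := symmetric_lower ip_norm (ext_symmetric wu)
    (resolvent_sub (ext_linear wu) Gf Gx').
  by rewrite Im_i normr1 mul1r.
have d2 : rnorm ((v' + 'i%R *: x' - l%:C *: x') - (f' - l%:C *: f)) <=
    rnorm (v - v') + Normc.normc ('i%R - l%:C) * rnorm (f - x').
  have -> : (v' + 'i%R *: x' - l%:C *: x') - (f' - l%:C *: f) =
      (v' - v) + ('i%R - l%:C) *: (x' - f).
    have -> : f' = v + 'i%R *: f by rewrite subrK.
    have e1 (t u : H) : t + 'i%R *: u - l%:C *: u = t + ('i%R - l%:C) *: u.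
      by rewrite scalerBl addrA.
    by rewrite !e1 opprD addrACA -scalerBr.
  by apply: le_trans (rnormD _ _) _; rewrite rnormZ rnormB (rnormB x').
have := rnormD (f - x') x'; rewrite subrK => h1.
have := rnormD ((v' + 'i%R *: x' - l%:C *: x') - (f' - l%:C *: f)) (f' - l%:C *: f).
rewrite subrK => h2.
have kk : rnorm (v - v') * K <= e by rewrite -ler_pdivlMr// ltW.
have cp : Normc.normc ('i%R - l%:C) * rnorm (f - x') <=
    Normc.normc ('i%R - l%:C) * rnorm (v - v') by rewrite ler_wpM2l ?normc_ge0.
have rf : r * rnorm f <= r * rnorm (v - v') + r * rnorm x'.
  by rewrite -mulrDr ler_wpM2l ?(ltW r0)//; apply: le_trans h1 _; rewrite lerD2r.
move: kk; rewrite /K => kk; lra.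
Qed.

End Gap.

Section WeakLimit.

Lemma rnorm_mid x y (e : R) : rnorm x <= e -> rnorm y <= e ->
  rnorm ((2^-1)%:C *: (x + y)) <= e.
Proof.
move=> xe ye; rewrite rnormZr ger0_norm ?invr_ge0//.
by have := rnormD x y; lra.
Qed.

Lemma mid_sub x y p q : (2^-1)%:C *: (x + y) - (2^-1)%:C *: (p + q) =
  (2^-1)%:C *: ((x - p) + (y - q)).
Proof. by rewrite -scalerBr opprD addrACA. Qed.

Lemma mid_subc x y u : (2^-1)%:C *: (x + y) - u = (2^-1)%:C *: ((x - u) + (y - u)).
Proof. by rewrite -mid_sub half_addxx. Qed.

(** Bounded eigenvectors have weak limits, which stay in the closed convex set
    [K] and are again eigenvectors. The limit is produced from the convex sets of
    approximate eigenvectors by [nested_midconvex]. *)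
Lemma eigenvec_closed (l : R) w (n : R) (K : set H) : midconvex K -> adherent K `<=` K ->
  (forall e : R, 0 < e -> exists l' w' x', [/\ eigenvec l' w' x', `|l - l'| < e,
     Normc.normc (w - w') < e, rnorm x' <= n & K x']) ->
  exists x, [/\ eigenvec l w x, rnorm x <= n & K x].
Proof.
move=> Kmid Kcl lim; have [M0 Ml Ma] := M_closed.
pose f1 x := x - up - w *: um.
pose f2 x := l%:C *: x - 'i%R *: up + ('i%R * w) *: um.
pose D (k : nat) : set H := [set x | [/\ K x, M x, rnorm x <= n & exists2 p, B p &
  rnorm (f1 x - p.1) <= k.+1%:R^-1 /\ rnorm (f2 x - p.2) <= k.+1%:R^-1]].
have f1mid x y : f1 ((2^-1)%:C *: (x + y)) = (2^-1)%:C *: (f1 x + f1 y).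
  by rewrite /f1 !mid_subc.
have f2mid x y : f2 ((2^-1)%:C *: (x + y)) = (2^-1)%:C *: (f2 x + f2 y).
  have e1 t : f2 t = l%:C *: t - ('i%R *: up - ('i%R * w) *: um) by rewrite /f2 opprB addrA addrAC.
  by rewrite !e1 -mid_subc -scalerDr !scalerA (mulrC l%:C).
have [k|k x|k x y|x []|z [f [Df zf]]] := @nested_midconvex _ _ _ ip_norm D n.
- have k0 : 0 < (k.+1%:R^-1 : R) by rewrite invr_gt0.
  have n0 : 0 < 1 + `|n| by rewrite ltr_pwDl.
  have [l' [w' [x' [[Mx' Bx'] ll' ww' x'n Kx']]]] := lim _ (divr_gt0 k0 n0).
  exists x'; split => //; eexists; first exact: Bx'.
  have um1 : rnorm um = 1 by rewrite /rnorm um_unit.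
  have i1 : Normc.normc 'i%R = 1 :> R by rewrite -complexiE /= expr0n expr1n add0r sqrtr1.
  have d0 : k.+1%:R^-1 / (1 + `|n|) <= (k.+1%:R^-1 : R).
    by rewrite ler_pdivrMr// ler_peMr ?(ltW k0)// lerDl.
  rewrite /f1 /f2 /=; split.
    have -> : x' - up - w *: um - (x' - up - w' *: um) = - ((w - w') *: um).
      by rewrite opprB addrC addrA subrK scalerBl opprB.
    rewrite rnormN rnormZ um1 mulr1; apply: le_trans d0; exact: ltW.
  have -> : l%:C *: x' - 'i%R *: up + ('i%R * w) *: um -
      (l'%:C *: x' - 'i%R *: up + ('i%R * w') *: um) =
      (l - l')%:C *: x' + ('i%R * (w - w')) *: um.
    rewrite opprD addrACA opprB [X in X + _]addrA subrK -!scalerBl -rmorphB /=.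
    by rewrite mulrBr.
  apply: le_trans (rnormD _ _) _.
  rewrite rnormZr rnormZ Normc.normcM i1 um1 mul1r mulr1.
  have x'n2 : rnorm x' <= `|n| by apply: le_trans x'n (ler_norm n).
  have -> : k.+1%:R^-1 = k.+1%:R^-1 / (1 + `|n|) * `|n| + k.+1%:R^-1 / (1 + `|n|) :> R.
    by field; rewrite gt_eqF//= gt_eqF// ltr0n.
  by rewrite lerD ?(ltW ww')// ler_pM ?normr_ge0 ?rnorm_ge0 ?(ltW ll').
- move=> [Kx Mx xn [p Bp [p1 p2]]]; split => //; exists p => //.
  have kk : (k.+2%:R^-1 : R) <= k.+1%:R^-1 by rewrite lef_pV2 ?posrE// ler_nat.
  by split; [exact: le_trans p1 kk|exact: le_trans p2 kk].
- move=> [Kx Mx xn [p Bp [p1 p2]]] [Ky My yn [q Bq [q1 q2]]]; split.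
  + exact: Kmid.
  + by apply: (subspaceZ _ M_closed); exact: (subspaceD M_closed).
  + exact: rnorm_mid.
  + exists ((2^-1)%:C *: (p.1 + q.1), (2^-1)%:C *: (p.2 + q.2)) => /=.
      by apply: opZ => //; apply: opD => //; [case: (p) Bp|case: (q) Bq].
    by rewrite f1mid f2mid !mid_sub; split; exact: rnorm_mid.
- by [].
exists z; split.
- split.
    by apply: Ma => e /zf[N /(_ _ (leqnn N))]; exists (f N) => //; case: (Df N).
  apply: (closed_pairP B_closed) => e e0.
  pose L := 1 + `|l|; have L0 : 0 < L by rewrite ltr_pwDl.
  have e1 : 0 < e / 2 / L by rewrite !divr_gt0.
  have e2 : 0 < e / 2 by rewrite divr_gt0.
  have [N1 N1P] := zf _ e1; have [N2 N2P] := invS_lt e2.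
  have := N1P _ (leq_maxl N1 N2); have := N2P _ (leq_maxr N1 N2).
  have [_ _ _ [p Bp]] := Df (maxn N1 N2); move: (f _) (_^-1) => y t [p1 p2] te zy.
  exists p => //=; rewrite -/(f1 z) -/(f2 z).
  have zy2 : rnorm (z - y) < e / 2.
    by apply: lt_le_trans zy _; rewrite ler_pdivrMr// ler_peMr ?(ltW e2)// lerDl.
  have lzy : `|l| * rnorm (z - y) < e / 2.
    apply: (@le_lt_trans _ _ (L * rnorm (z - y))).
      by rewrite ler_wpM2r ?rnorm_ge0// lerDr.
    by rewrite mulrC -ltr_pdivlMr.
  have d1 : f1 z - f1 y = z - y by exact: addr2_cancel.
  have d2 : f2 z - f2 y = l%:C *: (z - y) by rewrite scalerBr; exact: addr2_cancel.
  split.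
    have := rnorm_triangle (f1 y) (f1 z) p.1; rewrite d1; lra.
  have := rnorm_triangle (f2 y) (f2 z) p.2; rewrite d2 rnormZr; lra.
- apply/ler_addgt0Pr => e /zf[N /(_ _ (leqnn N)) zN].
  have [_ _ fn _] := Df N; have := rnormD (z - f N) (f N); rewrite subrK; lra.
- by apply: Kcl => e /zf[N /(_ _ (leqnn N))]; exists (f N) => //; case: (Df N).
Qed.

End WeakLimit.

(** The component of an eigenvector on [up] is not zero, by [B_no_eigenvector]. *)
Lemma eigenP w z : w * conjc w = 1 -> point_spectrum (op_restrict (ext w) M) z <->
  exists (l : R) x, z = l%:C /\ eigenvec l w x.
Proof.
move=> wu; split=> [[x x0 [/= Gx Mx]]|[l [x [-> ax]]]]; last first.
  exists x; first exact: (eigenvec_neq0 ax).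
  by split => /=; [exact: eigenvec_ext|case: ax].
have xr : (rnorm x)%:C != 0 :> R[i].
  by apply/eqP => /complexI/rnorm_eq0 xx; rewrite xx eqxx in x0.
have zr : z = (complex.Re z)%:C.
  have := ext_symmetric wu Gx Gx; rewrite /= ipZl ipZr (ip_self ip_norm).
  rewrite rmorphXn => /mulIf; rewrite expf_neq0// => /(_ isT).
  case: z {Gx} => p q [] /= h; congr (_ +i* _); lra.
exists (complex.Re z); rewrite zr /= in Gx *; move: (complex.Re z) Gx => l Gx.
have [[b d] [a [/= Bb [xE lxE]]]] := Gx.
have a0 : a != 0.
  apply: contra_neq x0 => a0; apply: (B_no_eigenvector Mx (l := l)).
  by rewrite lxE {1}xE a0 !mul0r !scale0r !addr0 subr0.
exists (a^-1 *: x); split => //; split; first exact: (subspaceZ _ M_closed).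
have := opZ a^-1 B_lin Bb; congr (B (_, _)).
  rewrite xE !scalerDr !scalerA mulrA mulVf// mul1r scale1r.
  by rewrite [_ + _ - up]addrAC addrK addrK.
have -> : l%:C *: (a^-1 *: x) = a^-1 *: (l%:C *: x) by rewrite !scalerA mulrC.
rewrite lxE !scalerDr scalerN !scalerA !mulrA mulVf// !mul1r.
by rewrite [_ + _ - _ - _]addrAC addrK subrK.
Qed.

(** * Countable decomposition of the eigenvalues *)

Lemma normc_conjc (c : R[i]) : Normc.normc (conjc c) = Normc.normc c.
Proof. by case: c => p q /=; rewrite sqrrN. Qed.

Lemma normc_sub_unit w w' : w' * conjc w' = 1 ->
  Normc.normc (1 - w * conjc w') = Normc.normc (w - w').
Proof.
move=> wu'; have n1 : Normc.normc w' * Normc.normc (conjc w') = 1.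
  by rewrite -Normc.normcM wu' Normc.normc1.
have n2 : Normc.normc (conjc w') = 1.
  move: n1; rewrite normc_conjc -expr2 => /eqP; rewrite sqrf_eq1 => /orP[/eqP//|/eqP h].
  by have := normc_ge0 w'; rewrite h ler0N1.
have -> : 1 - w * conjc w' = - ((w - w') * conjc w') by rewrite -{1}wu'; ring.
by rewrite normcN Normc.normcM n2 mulr1.
Qed.

Section Pieces.
Variables (w0 : R[i]) (w0u : w0 * conjc w0 = 1).
Let A := op_restrict (ext w0) M.
Let Asa : selfadjoint_on ip M A. Proof. exact: M_selfadjoint. Qed.

Implicit Types (n q rho l : R).

(** Closed and convex, so that it passes to weak limits; it bounds below the inner
    product that appears in [eigenvec_green]. *)
Definition positive_cone n q rho : set H := [set x | forall l w x',
  eigenvec l w x' -> rnorm x' <= n -> `|l - q| <= rho -> rho <= re_ip ip x' x].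

(** The single number [rho] is both the radius of the interval of eigenvalues and
    the lower bound in the cone. *)
Definition piece n q rho : set R[i] := [set w | exists l x,
  [/\ spectrum M A l%:C, `|l - q| <= rho, rnorm x <= n, positive_cone n q rho x
    & eigenvec l w x]].

Lemma cone_midconvex n q rho : midconvex (positive_cone n q rho).
Proof.
move=> x y Kx Ky l w x' ax x'n lq; have := Kx _ _ _ ax x'n lq; have := Ky _ _ _ ax x'n lq.
by rewrite ripZr ripDr; lra.
Qed.

Lemma cone_closed n q rho : adherent (positive_cone n q rho) `<=` positive_cone n q rho.
Proof.
move=> x aKx l w x' ax x'n lq; apply/ler_addgt0Pr => e e0.
have K0 : 0 < rnorm x' + 1 by rewrite ltr_wpDl ?rnorm_ge0.
have [y Ky xy] := aKx _ (divr_gt0 e0 K0).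
apply: le_trans (Ky _ _ _ ax x'n lq) _.
have -> : re_ip ip x' y = re_ip ip x' x + re_ip ip x' (y - x) by rewrite ripDr ripNr; lra.
rewrite lerD2l; apply: le_trans (rip_le ip_norm _ _) _; rewrite rnormB.
apply: (@le_trans _ _ (rnorm x' * (e / (rnorm x' + 1)))).
  by rewrite ler_wpM2l ?rnorm_ge0// ltW.
by rewrite mulrCA ler_piMr ?(ltW e0)// ler_pdivrMr// mul1r lerDl.
Qed.

Lemma eigenvec_gap l w x l' w' x' : eigenvec l w x -> eigenvec l' w' x' ->
  `|l - l'| * Normc.normc (ip x x') = 2 * Normc.normc (w - w').
Proof.
move=> ax ax'; have := congr1 (@Normc.normc R) (eigenvec_green ax ax').
rewrite !Normc.normcM (normc_sub_unit _ (eigenvec_unit ax')).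
have -> : Normc.normc ((l - l')%:C) = `|l - l'| by rewrite /= expr0n addr0 sqrtr_sqr.
have -> : Normc.normc 'i%R = 1 :> R.
  by rewrite -complexiE /= expr0n expr1n add0r sqrtr1.
have -> : Normc.normc 2 = 2 :> R.
  have -> : 2 = (2 : R)%:C by rewrite rmorph_nat.
  by rewrite /= expr0n addr0 sqrtr_sqr ger0_norm.
by rewrite mulr1.
Qed.

Lemma rip_le_normc x y : re_ip ip x y <= Normc.normc (ip x y).
Proof.
rewrite /re_ip; case: (ip x y) => a b /=; apply: (le_trans (ler_norm a)).
by rewrite -sqrtr_sqr ler_sqrt ?lerDl ?sqr_ge0// addr_ge0 ?sqr_ge0.
Qed.

(** Green's formula divided by the inner product, which is at least [rho]. *)
Lemma piece_lipschitz n q rho l w x l' w' x' :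
  `|l - q| <= rho -> rnorm x <= n -> eigenvec l w x ->
  positive_cone n q rho x' -> eigenvec l' w' x' ->
  rho * `|l - l'| <= 2 * Normc.normc (w - w').
Proof.
move=> lq xn ax Kx' ax'; rewrite -(eigenvec_gap ax ax') mulrC ler_wpM2l//.
exact: le_trans (Kx' _ _ _ ax xn lq) (rip_le_normc _ _).
Qed.

Lemma piece_closed n q rho w : 0 < rho ->
  (forall e : R, 0 < e -> exists2 w', piece n q rho w' & Normc.normc (w - w') < e) ->
  piece n q rho w.
Proof.
move=> rho0 lim.
have /choice[f fP] : forall k : nat, exists p : R[i] * R * H,
    [/\ spectrum M A p.1.2%:C, `|p.1.2 - q| <= rho, rnorm p.2 <= n,
      positive_cone n q rho p.2 & eigenvec p.1.2 p.1.1 p.2] /\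
    Normc.normc (w - p.1.1) < k.+1%:R^-1.
  move=> k; have k0 : 0 < (k.+1%:R^-1 : R) by rewrite invr_gt0.
  by have [w' [l [x h]] ww'] := lim _ k0; exists (w', l, x).
have lip k j : rho * `|(f k).1.2 - (f j).1.2| <= 2 * (k.+1%:R^-1 + j.+1%:R^-1).
  have [[_ kq kn _ ak] wk] := fP k; have [[_ _ _ Kj aj] wj] := fP j.
  apply: le_trans (piece_lipschitz kq kn ak Kj aj) _; rewrite ler_pM2l//.
  have -> : (f k).1.1 - (f j).1.1 = (w - (f j).1.1) - (w - (f k).1.1).
    by rewrite opprB [RHS]addrC addrA subrK.
  apply: le_trans (le_normcD _ _) _; rewrite normcN addrC lerD// ltW//.
have [e e0|l lP] := @complete_real R (fun k => (f k).1.2).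
  have e1 : 0 < rho * e / 4 by rewrite divr_gt0// mulr_gt0.
  have [N NP] := invS_lt e1; exists N => k j Nk Nj.
  rewrite -(ltr_pM2l rho0); apply: le_lt_trans (lip k j) _.
  by have := NP _ Nk; have := NP _ Nj; move: (k.+1%:R^-1) (j.+1%:R^-1) => s t; lra.
have near (e : R) : 0 < e -> exists k, `|l - (f k).1.2| < e /\ Normc.normc (w - (f k).1.1) < e.
  move=> e0; have [N1 N1P] := lP _ e0; have [N2 N2P] := invS_lt e0.
  exists (maxn N1 N2); split; first by apply: N1P; exact: leq_maxl.
  by have [_ h] := fP (maxn N1 N2); rewrite (lt_trans h)// N2P// leq_maxr.
have [e e0|x [ax xn Kx]] := @eigenvec_closed l w n (positive_cone n q rho)
    (@cone_midconvex n q rho) (@cone_closed n q rho) _.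
  have [k [lk wk]] := near _ e0; have [[_ _ ? ? ?] _] := fP k.
  by exists (f k).1.2, (f k).1.1, (f k).2.
exists l, x; split => //.
- apply: (spectrum_real_closed ip_norm M_closed Asa) => e /near[k [lk _]].
  by exists (f k).1.2 => //; have [[]] := fP k.
- apply/ler_addgt0Pr => e /near[k [lk _]]; have [[_ kq _ _ _] _] := fP k.
  have := ler_normD (l - (f k).1.2) ((f k).1.2 - q); rewrite addrA subrK; lra.
Qed.

(** Otherwise eigenvectors with eigenvalues tending to [l] would have a weak limit
    different from [x], but the limit has eigenvalue [l] and boundary parameter
    [w], by [eigenvec_gap], so it is [x]. *)
Lemma eigenvec_rip_near l w x (n : R) : eigenvec l w x ->
  exists2 d : R, 0 < d & forall l' w' x', eigenvec l' w' x' -> rnorm x' <= n ->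
    `|l - l'| < d -> rnorm x ^+ 2 / 2 <= re_ip ip x' x.
Proof.
move=> ax; apply: contrapT => far.
pose K := [set y | re_ip ip y x <= rnorm x ^+ 2 / 2].
have x0 : 0 < rnorm x.
  rewrite lt_def rnorm_ge0 andbT; apply: contra_neq (eigenvec_neq0 ax); exact: rnorm_eq0.
have [| |e e0|y [ay _ Ky]] := @eigenvec_closed l w n K.
- by move=> y z Ky Kz; rewrite /K /= ripZl ripDl; move: Ky Kz; rewrite /K /=; lra.
- move=> y aKy; rewrite /K /=; apply/ler_addgt0Pr => e e0.
  have [z Kz yz] := aKy _ (divr_gt0 e0 x0).
  have -> : re_ip ip y x = re_ip ip z x + re_ip ip (y - z) x by rewrite ripDl ripNl; lra.
  apply: lerD => //; apply: le_trans (rip_le ip_norm _ _) _.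
  by rewrite -ler_pdivlMr// ltW.
(* Green's formula makes the parameter close to [w] when the eigenvalue is close to [l] *)
- pose n1 := `|n| * rnorm x + 1.
  have n10 : 0 < n1 by rewrite ltr_wpDl// mulr_ge0// ltW.
  have d0 : 0 < Num.min e (e / n1) by rewrite lt_min e0 divr_gt0.
  apply: contrapT => no; apply: far; exists (Num.min e (e / n1)) => // l' w' x' ax' x'n.
  rewrite lt_min => /andP[le1 le2]; rewrite leNgt; apply/negP => small.
  apply: no; exists l', w', x'; split => //; last exact: ltW.
  have := eigenvec_gap ax ax' => gap.
  have x'n' : rnorm x' <= `|n| by exact: le_trans (ler_norm n).
  have : 2 * Normc.normc (w - w') <= e.
    rewrite -gap; apply: (@le_trans _ _ (e / n1 * n1)); last by rewrite divfK// gt_eqF.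
    rewrite ler_pM ?normc_ge0// ?(ltW le2)//; apply: le_trans (ip_le ip_norm _ _) _.
    rewrite /n1 mulrC; apply: (@le_trans _ _ (`|n| * rnorm x)); last by rewrite lerDl.
    by rewrite ler_wpM2r ?rnorm_ge0.
  lra.
move: Ky; rewrite /K /= (eigenvec_unique ay ax) (rip_self ip_norm).
by have := exprn_gt0 2 x0; lra.
Qed.

Lemma piece_cover l w x : spectrum M A l%:C -> eigenvec l w x ->
  exists (n : nat) (q : rat) (m : nat), piece n%:R (ratr q) m.+1%:R^-1 w.
Proof.
move=> sl ax; pose n := (Num.truncn (rnorm x)).+1.
have xn : rnorm x <= n%:R by rewrite ltW// truncnS_gt.
have [d d0 dP] := eigenvec_rip_near n%:R ax.
have x0 : 0 < rnorm x.
  rewrite lt_def rnorm_ge0 andbT; apply: contra_neq (eigenvec_neq0 ax); exact: rnorm_eq0.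
have e0 : 0 < Num.min (d / 2) (rnorm x ^+ 2 / 2).
  by rewrite lt_min !divr_gt0// exprn_gt0.
have [m /(_ m (leqnn m))] := invS_lt e0.
rewrite lt_min => /andP[m1 m2].
have rho0 : 0 < (m.+1%:R^-1 : R) by rewrite invr_gt0.
have [q] : exists q : rat, ratr q \in `]l, (l + m.+1%:R^-1)[.
  by apply: rat_in_itvoo; rewrite ltrDl.
rewrite in_itv /= => /andP[q1 q2].
have lq : `|l - ratr q| <= m.+1%:R^-1.
  by move: m1 m2 rho0 q2; move: (m.+1%:R^-1) => t *; rewrite ler_norml; lra.
exists n, q, m, l, x; split => // l' w' x' ax' x'n l'q.
apply: le_trans (ltW m2) _; apply: (dP _ _ _ ax' x'n).
apply: le_lt_trans (ler_distD (ratr q) l l') _; rewrite (distrC _ l').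
by move: m1 lq l'q; move: (m.+1%:R^-1) => t; lra.
Qed.

(** [x] and [up] both solve an eigenvalue equation for the adjoint of [B], and
    [x - (1 - w w0^* ) up] satisfies the boundary condition of [ext w0]. *)
Lemma eigenvec_resolvent_up (s : R) w x : eigenvec s w x -> w != w0 ->
  exists2 y, A (y, up + s%:C *: y) &
    Normc.normc (w - w0) * rnorm y <= rnorm x + Normc.normc (w - w0).
Proof.
move=> ax ww0; have [c cE] : exists c, c = 1 - w * conjc w0 by eexists.
have nc : Normc.normc c = Normc.normc (w - w0) by rewrite cE; exact: normc_sub_unit.
have c0 : c != 0.
  apply/eqP => c0; move/eqP: ww0; apply; apply/eqP; rewrite -subr_eq0; apply/eqP.
  by apply: Normc.eq0_normc; rewrite -nc c0 Normc.normc0.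
have si0 : s%:C - 'i%R != 0 :> R[i].
  by apply/eqP => /(congr1 (@complex.Im R)); rewrite -complexiE /=; lra.
have sin1 : 1 <= Normc.normc (s%:C - 'i%R : R[i]).
  rewrite -complexiE /= sub0r sqrrN expr1n subr0 -[leLHS]sqrtr1 ler_wsqrtr//.
  by rewrite lerDr sqr_ge0.
have Gx : ext w0 (x - c *: up, s%:C *: x - (c * 'i%R) *: up).
  have [_ Bx] := ax.
  exists (x - up - w *: um, s%:C *: x - 'i%R *: up + ('i%R * w) *: um), (1 - c).
  split => //=.
  have cw : (1 - c) * w0 = w by rewrite cE subKr -mulrA (mulrC _ w0) w0u mulr1.
  rewrite (mulrAC _ 'i%R) cw; congr (_, _).
    rewrite scalerBl scale1r addrA [x - up - _ + _]addrAC subrK.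
    by rewrite [RHS]addrAC subrK.
  rewrite mulrBl mul1r scalerBl addrA [_ - 'i%R *: up + _ + _]addrAC subrK.
  by rewrite (mulrC 'i%R w) [RHS]addrAC addrK.
have [_ _ Ma] := M_closed.
have Mx : M (x - c *: up).
  by case: ax => Mx _; apply: (subspaceB M_closed) => //; exact: (subspaceZ _ M_closed M_up).
pose k := (c * (s%:C - 'i%R))^-1.
have kc : k * c * (s%:C - 'i%R) = 1 by rewrite -mulrA mulVf// mulf_neq0.
exists (k *: (x - c *: up)).
  split => /=; last exact: (subspaceZ _ M_closed).
  have := opZ k (ext_linear w0u) Gx; congr (ext w0 (_, _)).
  have up1 : up = (k * c * (s%:C - 'i%R)) *: up by rewrite kc scale1r.
  rewrite !scalerBr !scalerA {2}up1 addrCA -scalerBl -scaleNr.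
  by congr (_ *: _ + _ *: _); ring.
rewrite -nc rnormZ Normc.normcV Normc.normcM mulrA invfM mulrA mulfV; last first.
  by apply: contra_neq c0; exact: Normc.eq0_normc.
rewrite mul1r; apply: (@le_trans _ _ (rnorm (x - c *: up))).
  by rewrite ler_piMl ?rnorm_ge0// invf_le1// (lt_le_trans ltr01).
apply: le_trans (rnormD _ _) _; rewrite rnormN rnormZ lerD2l.
by rewrite [rnorm up](_ : _ = 1) ?mulr1// /rnorm up_unit.
Qed.

(** Along an arc the eigenvalue would sweep an interval contained in the spectrum
    of [A], on which the resolvent of [A] applied to [up] is bounded. *)
Lemma piece_no_arc n q rho (W : R -> R[i]) (a b d : R) : 0 < rho -> 0 < d -> a < b ->
  W a != W b ->
  (forall t e : R, 0 < e -> exists2 h : R, 0 < h & forall t', `|t - t'| < h ->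
     Normc.normc (W t - W t') < e) ->
  (forall t, a <= t <= b -> d <= Normc.normc (W t - w0)) ->
  ~ (forall t, a <= t <= b -> piece n q rho (W t)).
Proof.
move=> rho0 d0 ab Wab Wcont Wd arc.
have /choice[f fP] : forall t, exists p : R * H, a <= t <= b ->
    [/\ spectrum M A p.1%:C, `|p.1 - q| <= rho, rnorm p.2 <= n,
      positive_cone n q rho p.2 & eigenvec p.1 (W t) p.2].
  move=> t; case: (boolP (a <= t <= b)) => [/arc[l [x h]]|_]; last by exists (0, 0).
  by exists (l, x).
pose lam t := (f t).1.
have lam_cont : {within `[a, b], continuous lam}.
  apply/subspace_continuousP => t; rewrite /= in_itv /= => tab.
  apply/cvgrPdist_lt => e e0.
  have re0 : 0 < rho * e / 2 by rewrite divr_gt0// mulr_gt0.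
  have [h h0 hW] := Wcont t _ re0.
  have [_ tq tn _ at_] := fP t tab.
  rewrite near_withinE; near=> t' => t'ab; rewrite /= in_itv /= in t'ab.
  have [_ _ _ Kt' at'] := fP t' t'ab.
  rewrite -(ltr_pM2l rho0); apply: le_lt_trans (piece_lipschitz tq tn at_ Kt' at') _.
  have tt' : `|t - t'| < h by near: t'; exact: nbhsx_ballx.
  by have := hW _ tt'; lra.
have aab : a <= a <= b by rewrite lexx ltW.
have bab : a <= b <= b by rewrite lexx ltW.
have lab : lam a != lam b.
  apply/eqP => lab; have [_ _ _ _ aa] := fP a aab; have [_ _ _ _ ab'] := fP b bab.
  have := eigenvec_gap aa ab'; rewrite -/(lam a) lab subrr normr0 mul0r => /esym/eqP.
  rewrite mulf_eq0 pnatr_eq0 /= => /eqP/Normc.eq0_normc/eqP.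
  by rewrite subr_eq0 (negPf Wab).
pose lo := Num.min (lam a) (lam b); pose hi := Num.max (lam a) (lam b).
have lohi : lo < hi by rewrite /lo /hi; case: (ltgtP (lam a) (lam b)) lab.
have sweep s : lo <= s <= hi -> exists2 t, a <= t <= b & lam t = s.
  by move=> sI; have [t] := IVT (ltW ab) lam_cont sI; rewrite in_itv; exists t.
pose l := (lo + hi) / 2; pose r := (hi - lo) / 2.
have r0 : 0 < r by rewrite divr_gt0// subr_gt0.
have [|t tab lt_] := sweep l; first by rewrite /l; lra.
have [sl _ _ _ _] := fP t tab; rewrite -/(lam t) lt_ in sl.
apply: sl; apply: (@gap_resolvent_set w0 w0u l r (n / d + 1) r0) => s srl.
have [|t' t'ab <-] := sweep s; first by move: srl; rewrite /l /r; lra.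
have [_ _ xn _ at'] := fP t' t'ab; have Wt := Wd _ t'ab.
have Wt0 : 0 < Normc.normc (W t' - w0) by exact: lt_le_trans Wt.
have [|y Ay yn] := eigenvec_resolvent_up at'.
  by apply/eqP => h; move: Wt0; rewrite h subrr Normc.normc0 ltxx.
exists y => //; rewrite -(ler_pM2l Wt0); apply: le_trans yn _.
rewrite mulrDr mulr1 lerD2r; apply: (le_trans xn).
rewrite mulrCA ler_peMr//; last by rewrite ler_pdivlMr// mul1r.
exact: le_trans (rnorm_ge0 _) xn.
Unshelve. all: by end_near. Qed.

End Pieces.

End Extensions.

(** * Boundary parameters and the category argument *)

Section BoundaryParameter.
Variable R : realType.
Implicit Types (s t e : R).

Definition bparam t : R[i] := cis (- (2 * t)).

Lemma bparam_unit t : bparam t * conjc (bparam t) = 1.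
Proof.
apply/eqP; rewrite /bparam /cis eq_complex /= mulrN opprK -!expr2 cos2Dsin2 eqxx /=.
by rewrite mulrN mulrC addNr.
Qed.

Lemma bparam_neq s t : 0 < t - s < pi -> bparam s != bparam t.
Proof.
move=> /sin_gt0_pi ts; apply/eqP => -[]; rewrite !cosN !sinN => c s1.
have c1 : cos ((2 * t) - (2 * s)) = 1.
  rewrite cosB c; move/oppr_inj : s1 => ->.
  by rewrite -!expr2 cos2Dsin2.
have e1 : 2 * t - 2 * s = (t - s) + (t - s) by ring.
rewrite e1 cosD in c1; have := cos2Dsin2 (t - s); nra.
Qed.

Lemma bparam_continuous t e : 0 < e ->
  exists2 h : R, 0 < h & forall t', `|t - t'| < h ->
     Normc.normc (bparam t - bparam t') < e.
Proof.
move=> e0; have e2 : 0 < e / 2 by rewrite divr_gt0.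
have cc (f : R -> R) : continuous f -> exists2 h : R, 0 < h &
    forall t', `|t - t'| < h -> `|f (- (2 * t)) - f (- (2 * t'))| < e / 2.
  move=> fc; have : (fun u => f (- (2 * u))) @ t --> f (- (2 * t)).
    apply: continuous_comp; last exact: fc.
    by apply: cvgN; apply: cvgM; [exact: cvg_cst|exact: cvg_id].
  move=> /cvgrPdist_lt/(_ _ e2)/nbhs_ballP; case=> h /= h0 hP.
  by exists h => // t' tt'; exact: hP.
have [h1 h10 c1] := cc _ (@continuous_cos R).
have [h2 h20 c2] := cc _ (@continuous_sin R).
exists (Num.min h1 h2) => [|t']; first by rewrite lt_min h10.
rewrite lt_min => /andP[/c1 d1 /c2 d2].
rewrite /bparam /cis /=; move: (_ - _) (_ - _) d1 d2 => p q p2 q2.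
have pq : p ^+ 2 + q ^+ 2 <= (`|p| + `|q|) ^+ 2.
  rewrite sqrrD !real_normK ?num_real//.
  by rewrite -addrA lerD2l addrC lerDl mulrn_wge0// mulr_ge0.
apply: le_lt_trans (_ : `|p| + `|q| < e); last by lra.
by rewrite -[leRHS]ger0_norm ?addr_ge0// -sqrtr_sqr ler_wsqrtr// addrC.
Qed.

End BoundaryParameter.

(** Baire's theorem on the line; a relatively open subset of the interval
    contains interior points of it. *)
Lemma dense_Gdelta_itv (R : realType) (a b : R) (F : nat -> set R)
    (E : set (`[a, b]%classic : set R)) : a < b ->
  (forall k, closed (F k)) ->
  (forall k (s t : R), s < t -> ~ (`[s, t]%classic `<=` F k)) ->
  (forall x, E x <-> forall k, ~ F k (\val x)) ->
  dense E /\ Gdelta E.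
Proof.
move=> ab Fc Fi EF.
have EE : E = \bigcap_k (set_val @^-1` (~` F k)).
  apply/seteqP; split => x; first by move=> /(proj1 (EF x)) h k _; exact: h.
  by move=> h; apply/(proj2 (EF x)) => k; exact: h.
split; last first.
  exists (fun k => set_val @^-1` (~` F k)) => // k.
  by exists (~` F k) => //; exact: closed_openC.
have dF : dense (\bigcap_k (~` F k)).
  apply: (@Baire R R) => k; split; first exact: closed_openC.
  move=> O [x Ox] Oo; apply: contrapT => no.
  have OF : O `<=` F k.
    by move=> y Oy; apply: contrapT => nF; apply: no; exists y.
  have /nbhs_ballP[e /= e0 eO] : nbhs x O by apply: open_nbhs_nbhs.
  apply: (Fi k x (x + e / 2)); first by rewrite ltrDl divr_gt0.
  move=> y /=; rewrite in_itv /= => /andP[xy ye]; apply/OF/eO.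
  rewrite -ball_normE /= distrC ger0_norm ?subr_ge0//; lra.
move=> O [x Ox] [V Vo VO].
have Vx : V (\val x) by move: Ox; rewrite -VO.
have /nbhs_ballP[e /= e0 eV] : nbhs (\val x) V by apply: open_nbhs_nbhs.
have xab : a <= \val x <= b by have := set_valP x; rewrite /= in_itv.
have V1o : open (V `&` `]a, b[%classic).
  by apply: openI => //; exact: interval_open.
have [|y [[Vy yab] Fy]] := dF _ _ V1o.
  have inV y : `|\val x - y| < e -> a < y < b -> (V `&` `]a, b[%classic) !=set0.
    by move=> xy yab; exists y; split; [apply: eV; rewrite -ball_normE|rewrite /= in_itv].
  move: xab; rewrite le_eqVlt => /andP[/orP[/eqP xa _|ax xb]].
    have h0 : 0 < Num.min (e / 2) ((b - a) / 2) by rewrite lt_min !divr_gt0// subr_gt0.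
    have h1 : Num.min (e / 2) ((b - a) / 2) <= e / 2 by rewrite ge_min lexx.
    have h2 : Num.min (e / 2) ((b - a) / 2) <= (b - a) / 2 by rewrite ge_min lexx orbT.
    apply: (inV (a + Num.min (e / 2) ((b - a) / 2))); move: (Num.min _ _) h0 h1 h2 => h h0 h1 h2.
      by rewrite -xa distrC addrC addKr ger0_norm; lra.
    by apply/andP; split; lra.
  have h0 : 0 < Num.min (e / 2) ((\val x - a) / 2) by rewrite lt_min !divr_gt0// subr_gt0.
  have h1 : Num.min (e / 2) ((\val x - a) / 2) <= e / 2 by rewrite ge_min lexx.
  have h2 : Num.min (e / 2) ((\val x - a) / 2) <= (\val x - a) / 2 by rewrite ge_min lexx orbT.
  apply: (inV (\val x - Num.min (e / 2) ((\val x - a) / 2))); move: (Num.min _ _) h0 h1 h2 => h h0 h1 h2.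
    by rewrite subKr ger0_norm; lra.
  by apply/andP; split; lra.
have yab' : y \in `[a, b]%classic.
  by rewrite inE /=; move: yab; rewrite /= !in_itv /= => /andP[? ?]; rewrite !ltW.
exists (SigSub yab'); split; first by rewrite -VO.
by apply/(proj2 (EF _)) => k; exact: Fy.
Qed.

Theorem theorem5p12 (R : realType) (H : completeNormedModType R[i])
    (ip : {dot H for conjC}) (ip_norm : norm_of_ip ip)
    (B : set (H * H)) (B_lin : linear_operator B)
    (B_dense : densely_defined B) (B_closed : closed_operator B)
    (B_sym : symmetric_operator ip B) (B_def : deficiency_indices ip B 1 1)
    (uplus uminus : H)
    (uplus_K : Kplus ip B uplus) (uplus_unit : `|uplus| = 1)
    (uminus_K : Kminus ip B uminus) (uminus_unit : `|uminus| = 1)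
    (theta1 : R) (theta1_bounds : 0 <= theta1 < pi)
    (theta0 : R) (theta0_bounds : 0 <= theta0 < pi) :
  let T := T_ext B uplus uminus in
  let M := cyclicity_space (T theta1) uplus in
  let E := [set theta : (`[0%R, pi]%classic : set R) |
              point_spectrum (op_restrict (T (\val theta)) M) `&`
              spectrum M (op_restrict (T theta0) M) = set0] in
  dense E /\ Gdelta E.
Proof.
move=> T M E.
pose A := op_restrict (T theta0) M.
pose w1 := bparam theta1; pose w0 := bparam theta0.
have w1u : w1 * conjc w1 = 1 := bparam_unit theta1.
have w0u : w0 * conjc w0 = 1 := bparam_unit theta0.
pose P n q m := piece ip B uplus uminus w1 w0 n q m.
pose F (k : nat) : set R := if unpickle k is Some (n, q, m)
  then [set t | P (n : nat)%:R (ratr (q : rat)) (m : nat).+1%:R^-1 (bparam t)] else set0.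
have inv0 m : 0 < (m.+1%:R^-1 : R) by rewrite invr_gt0.
apply: (@dense_Gdelta_itv R 0 pi F); first exact: pi_gt0.
- move=> k; rewrite /F; case: unpickle => [[[n q] m]|]; last exact: closed0.
  move=> t ct; rewrite /= /P; apply: piece_closed => // e e0.
  have [h h0 hP] := bparam_continuous t e0.
  have [s [Ps]] := ct _ (nbhsx_ballx t h h0).
  by rewrite -ball_normE /= => ts; exists (bparam s) => //; exact: hP.
- move=> k s t st; rewrite /F; case: unpickle => [[[n q] m]|]; last first.
    by move=> /(_ s); apply; rewrite /= in_itv /= lexx ltW.
  move=> sub.
  (* the arc starts at a point [c] with parameter different from [w0], so as to stay away from [w0] *)
  pose c := if bparam s != w0 then s else s + Num.min (t - s) 1 / 2.
  have pi1 : 1 < pi :> R by have := pi_ge2 R; lra.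
  have ts0 : 0 < t - s by rewrite subr_gt0.
  have mn0 : 0 < Num.min (t - s) 1 by rewrite lt_min ts0 ltr01.
  have mn1 : Num.min (t - s) 1 <= 1 by rewrite ge_min lexx orbT.
  have mnt : Num.min (t - s) 1 <= t - s by rewrite ge_min lexx.
  have [cs ct cw0] : [/\ s <= c, c < t & bparam c != w0].
    rewrite /c; case: (eqVneq (bparam s) w0) => /= [sw|sw]; last by rewrite lexx st sw.
    split.
    - by move: (Num.min _ _) mn0 => *; lra.
    - by move: (Num.min _ _) mn0 mnt => *; lra.
    - rewrite -sw eq_sym bparam_neq//; move: (Num.min _ _) mn0 mn1 => u u0 u1.
      by apply/andP; split; lra.
  pose d := Normc.normc (bparam c - w0) / 2.
  have n0 : 0 < Normc.normc (bparam c - w0).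
    rewrite lt_def normc_ge0 andbT; apply: contra_neq cw0 => /Normc.eq0_normc/eqP.
    by rewrite subr_eq0 => /eqP.
  have d0 : 0 < d by rewrite divr_gt0.
  have [h h0 hP] := bparam_continuous c d0.
  pose b := Num.min t (c + Num.min (h / 2) 1).
  have cb : c < b by rewrite lt_min ct ltrDl lt_min divr_gt0//= ltr01.
  have h2 : Num.min (h / 2) 1 <= h / 2 by rewrite ge_min lexx.
  have h1 : Num.min (h / 2) 1 <= 1 by rewrite ge_min lexx orbT.
  have bc : b <= c + Num.min (h / 2) 1 by rewrite ge_min lexx orbT.
  have bt : b <= t by rewrite ge_min lexx.
  have Wcb : bparam c != bparam b.
    apply: bparam_neq; move: (Num.min (h / 2) 1) h1 bc => u u1 bu.
    by apply/andP; split; lra.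
  have far u : c <= u <= b -> d <= Normc.normc (bparam u - w0).
    move=> /andP[cu ub].
    have cuh : `|c - u| < h.
      rewrite distrC ger0_norm ?subr_ge0//.
      by move: (Num.min (h / 2) 1) h2 bc => v v2 bv; lra.
    have := le_normcD (bparam c - bparam u) (bparam u - w0).
    rewrite addrA subrK; have := hP _ cuh; rewrite /d; lra.
  have arc u : c <= u <= b -> P n%:R (ratr q) m.+1%:R^-1 (bparam u).
    move=> /andP[cu ub]; apply: (sub u); rewrite /= in_itv /=.
    by rewrite (le_trans cs cu) (le_trans ub bt).
  apply: (piece_no_arc ip_norm B_lin B_dense B_closed B_sym B_def uplus_K
    uplus_unit uminus_K uminus_unit w1u w0u (inv0 m) d0 cb Wcb _ far arc).
  exact: bparam_continuous.
have eig (t : R) (z : R[i]) := eigenP ip_norm B_lin B_sym uplus_K uplus_unit uminus_K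
  uminus_unit w1u z (bparam_unit t).
move=> x; split=> [Ex k|nF].
  rewrite /F; case: unpickle => [[[n q] m]|] // [l [y [sl _ _ _ ay]]].
  have : (set0 : set R[i]) l%:C.
    by rewrite -Ex; split => //; apply/(proj2 (eig _ _)); exists l, y.
  by [].
apply/seteqP; split => // z [/= /(proj1 (eig _ _))[l [y [-> ay]]] sz].
have [n [q [m nqm]]] := piece_cover ip_norm B_lin B_closed B_sym
  uplus_K uplus_unit uminus_K uminus_unit w1u sz ay.
by apply: (nF (pickle (n, q, m))); rewrite /F pickleK.
Qed.
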